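(* Let $A_0(t)$ be an operator-valued function (on a finite-dimensional space) analytic in $t$ over the reals, $\alpha$ real, and define $\alpha A_j(t)$ recursively by $$\alpha A_{j+1}(t)=\sum_{m=1}^\infty(-1)^m\frac{m}{(m+1)!}\,\mathrm{ad}^m_{\int_0^t\alpha A_j(s)ds}\big[\alpha A_j(t)\big].$$ Let $U(t)=\mathcal{T}e^{\int_0^t\alpha A_0(s)ds}$ and $U_F(t)=\prod_{j=0}^{k-1}e^{\int_0^t\alpha A_j(s)ds}$ (factor $j=0$ leftmost). Then $$\|U_F(t)-U(t)\|=O\big(\alpha^{2^k}t^{2^{k+1}-1}\big).$$
   Context: $\mathcal{T}e^{\int_0^tX(s)ds}$ denotes the time-ordered exponential, i.e. the solution $W(t)$ of $W'(t)=X(t)W(t)$, $W(0)=I$. $\mathrm{ad}_X(Y)=[X,Y]$, $\mathrm{ad}_X^m=\mathrm{ad}_X\circ\mathrm{ad}_X^{m-1}$. The factor $-i$ is absorbed into $A_0$ (e.g. $A_0$ anti-Hermitian), so that $U$ and $U_F$ are bounded. $\|\cdot\|$ is the operator norm; asymptotics refer to small $\alpha,t$. *)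

(* Defs.v *)
From HB Require Import structures.
From mathcomp Require Import all_boot all_order all_algebra.
From mathcomp Require Import all_classical all_reals all_analysis.
From mathcomp Require Import complex.
Set Implicit Arguments. Unset Strict Implicit. Unset Printing Implicit Defensive.
Import Order.TTheory GRing.Theory Num.Theory.
Import numFieldNormedType.Exports.
Local Open Scope classical_set_scope.
Local Open Scope ring_scope.
Local Open Scope complex_scope.

Section Defs.
Variable R : realType.
Local Notation C := (R[i]).

Definition mkC (a b : R) : C := Complex a b.

Definition limC (u : nat -> C) : C :=
  mkC (limn (fun k => complex.Re (u k))) (limn (fun k => complex.Im (u k))).

Definition seriesC (u : nat -> C) : C :=
  limC (fun N => \sum_(k < N) u k).

Definition mxseries n (u : nat -> 'M[C]_n) : 'M[C]_n :=
  \matrix_(i, j) seriesC (fun k => u k i j).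

Definition expm n (A : 'M[C]_n) : 'M[C]_n :=
  mxseries (fun k => ((k`!)%:R)^-1 *: (A ^+ k)).

Definition oint (f : R -> R) (t : R) : R :=
  if 0 <= t then Rintegral lebesgue_measure `[0, t] f
  else - Rintegral lebesgue_measure `[t, 0] f.

Definition mxint n (F : R -> 'M[C]_n) (t : R) : 'M[C]_n :=
  \matrix_(i, j) mkC (oint (fun s => complex.Re (F s i j)) t)
                     (oint (fun s => complex.Im (F s i j)) t).

Definition ad n (X Y : 'M[C]_n) : 'M[C]_n := X * Y - Y * X.

Definition real_analytic (f : R -> R) : Prop :=
  forall t0 : R, exists r : R, 0 < r /\ exists c : nat -> R,
    forall t : R, `|t - t0| < r ->
      (fun N => \sum_(k < N) c k * (t - t0) ^+ k) @ \oo --> f t.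

Definition mx_analytic n (F : R -> 'M[C]_n) : Prop :=
  forall i j, real_analytic (fun t => complex.Re (F t i j)) /\
              real_analytic (fun t => complex.Im (F t i j)).

Definition mx_is_derive n (W : R -> 'M[C]_n) (t : R) (D : 'M[C]_n) : Prop :=
  forall i j, is_derive t 1 (fun s => complex.Re (W s i j)) (complex.Re (D i j)) /\
              is_derive t 1 (fun s => complex.Im (W s i j)) (complex.Im (D i j)).

(* W is the time-ordered exponential T e^{\int_0^t X}, i.e. the solution of
   W' = X W, W(0) = I *)
Definition is_TOexp n (X W : R -> 'M[C]_n) : Prop :=
  W 0 = 1 /\ forall t, mx_is_derive W t (X t * W t).

Fixpoint alphaA n (A0 : R -> 'M[C]_n) (alpha : R) (j : nat) (t : R) : 'M[C]_n :=
  match j with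
  | 0 => (alpha%:C) *: A0 t
  | j'.+1 =>
      let Om := mxint (alphaA A0 alpha j') t in
      mxseries (fun m => if m is 0 then 0 else
         (((-1) ^+ m * (m%:R) / ((m.+1)`!)%:R) : C) *:
           iter m (ad Om) (alphaA A0 alpha j' t))
  end.

Definition UF n (A0 : R -> 'M[C]_n) (alpha : R) (k : nat) (t : R) : 'M[C]_n :=
  \prod_(j < k) expm (mxint (alphaA A0 alpha j) t).

Definition modC (z : C) : R :=
  Num.sqrt (complex.Re z ^+ 2 + complex.Im z ^+ 2).

Definition vnorm n (v : 'cV[C]_n) : R :=
  Num.sqrt (\sum_i modC (v i 0) ^+ 2).

Definition opnorm n (A : 'M[C]_n) : R :=
  sup [set vnorm (A *m v) | v in [set v : 'cV[C]_n | vnorm v = 1]].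

End Defs.

(* Main.v *)
(** Write [Omega_j] for the integral of [A_j] from [0].  The recursion for [A_(j+1)] is exactly
[(exp (- Omega_j))' = A_(j+1) exp (- Omega_j) - exp (- Omega_j) A_j], so factoring
[exp Omega_j] out of a solution of [W' = A_j W] leaves a solution of [W' = A_(j+1) W].  Hence
[U] is [U_F] times the solution driven by [A_k], which differs from the identity by the size of
the integral of [A_k].  If [A_j] has size [al^a t^p], then the commutator of [Omega_j] and
[A_j] has size [al^(2a) t^(2p+2)] and not just [al^(2a) t^(2p+1)], because the leading Taylor
coefficients of [Omega_j] and [A_j] are proportional.  All estimates being asymptotic, the
exponentials and the commutator series may be truncated at a high order [M]: the differential
equations then hold up to [O(al^M t^M)], and every identity is between polynomials. *)
Require Import Defs.
From HB Require Import structures.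
From mathcomp Require Import all_boot all_order all_algebra.
From mathcomp Require Import all_classical all_reals all_analysis.
From mathcomp Require Import complex.
From mathcomp Require Import ring lra zify.
Import Order.TTheory GRing.Theory Num.Theory.
Import numFieldNormedType.Exports.
Local Open Scope classical_set_scope.
Local Open Scope ring_scope.
Local Open Scope complex_scope.

(** * Entrywise norms and derivatives of complex matrices *)

Section Matrices.
Context {R : realType} {n : nat}.
Implicit Types (A B X Y : 'M[R[i]]_n) (z w : R[i]) (x y : R).

(** A boolean index lets one statement about real functions serve both the real and the imaginary
    part. *)
Definition part (b : bool) z : R := if b then complex.Re z else complex.Im z.

Lemma partD b z w : part b (z + w) = part b z + part b w.
Proof. by case: b z w => [] [? ?] [? ?]. Qed.
Lemma partN b z : part b (- z) = - part b z.
Proof. by case: b z => [] [? ?]. Qed.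
Lemma part0 b : part b 0 = 0.
Proof. by case: b. Qed.
Lemma partZ b x z : part b (x%:C * z) = x * part b z.
Proof. by case: b z => [] [? ?] /=; rewrite mul0r ?subr0 ?addr0. Qed.
Lemma part_sum b (I : Type) (r : seq I) (P : pred I) (F : I -> R[i]) :
  part b (\sum_(i <- r | P i) F i) = \sum_(i <- r | P i) part b (F i).
Proof. by apply: (big_morph (part b)); [exact: partD|exact: part0]. Qed.
Lemma partM b z w : part b (z * w) =
  if b then part true z * part true w - part false z * part false w
  else part true z * part false w + part false z * part true w.
Proof. by case: b z w => [] [? ?] [? ?]. Qed.

Definition norm1 z : R := `|part true z| + `|part false z|.

Lemma norm1_ge0 z : 0 <= norm1 z.
Proof. by rewrite /norm1 addr_ge0 ?normr_ge0. Qed.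
Lemma norm1D z w : norm1 (z + w) <= norm1 z + norm1 w.
Proof. by rewrite /norm1 !partD addrACA lerD ?ler_normD. Qed.
Lemma norm1M z w : norm1 (z * w) <= norm1 z * norm1 w.
Proof.
rewrite /norm1 !partM mulrDl !mulrDr -!normrM.
apply: le_trans (lerD (ler_normB _ _) (ler_normD _ _)) _.
by lra.
Qed.
Lemma norm1Z x z : norm1 (x%:C * z) = `|x| * norm1 z.
Proof. by rewrite /norm1 !partZ !normrM mulrDr. Qed.
Lemma norm1N z : norm1 (- z) = norm1 z.
Proof. by rewrite /norm1 !partN !normrN. Qed.
Lemma norm1_0 : norm1 0 = 0.
Proof. by rewrite /norm1 !part0 normr0 addr0. Qed.
Lemma norm1_sum (I : Type) (r : seq I) (P : pred I) (F : I -> R[i]) :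
  norm1 (\sum_(i <- r | P i) F i) <= \sum_(i <- r | P i) norm1 (F i).
Proof.
apply: (big_ind2 (fun z x => norm1 z <= x)); rewrite ?norm1_0 //.
by move=> z x w y zx wy; apply: le_trans (norm1D _ _) (lerD zx wy).
Qed.

(** This norm replaces the operator norm in all estimates: it is submultiplicative and controlled by
    the real coordinates of the matrix, so bounds reduce to scalar real analysis. *)
Definition mxnorm1 A : R := \sum_i \sum_j norm1 (A i j).

Lemma mxnorm1_ge0 A : 0 <= mxnorm1 A.
Proof. by do 2!apply: sumr_ge0 => ? _; exact: norm1_ge0. Qed.
Lemma mxnorm1D A B : mxnorm1 (A + B) <= mxnorm1 A + mxnorm1 B.
Proof.
rewrite /mxnorm1 -big_split ler_sum// => i _ /=.
by rewrite -big_split ler_sum// => j _ /=; rewrite mxE norm1D.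
Qed.
Lemma mxnorm1N A : mxnorm1 (- A) = mxnorm1 A.
Proof. by do 2!apply: eq_bigr => ? _; rewrite mxE norm1N. Qed.
Lemma mxnorm1B A B : mxnorm1 (A - B) <= mxnorm1 A + mxnorm1 B.
Proof. by rewrite -(mxnorm1N B) mxnorm1D. Qed.
Lemma mxnorm1_0 : mxnorm1 0 = 0.
Proof. by rewrite /mxnorm1 !big1// => i _; rewrite big1// => j _; rewrite mxE norm1_0. Qed.
Lemma mxnorm1Z x A : mxnorm1 (x%:C *: A) = `|x| * mxnorm1 A.
Proof.
rewrite /mxnorm1 mulr_sumr; apply: eq_bigr => i _; rewrite mulr_sumr.
by apply: eq_bigr => j _; rewrite mxE norm1Z.
Qed.
Lemma mxnorm1M A B : mxnorm1 (A * B) <= mxnorm1 A * mxnorm1 B.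
Proof.
rewrite /mxnorm1 mulr_suml ler_sum// => i _.
have: \sum_j norm1 ((A * B) i j) <= \sum_j \sum_k norm1 (A i k) * norm1 (B k j).
  rewrite ler_sum// => j _; rewrite mxE; apply: le_trans (norm1_sum _ _ _ _) _.
  by rewrite ler_sum// => k _; rewrite norm1M.
move=> /le_trans; apply; rewrite exchange_big mulr_suml ler_sum// => k _.
rewrite -mulr_sumr ler_wpM2l ?norm1_ge0//.
rewrite [leRHS](bigD1 k)//= lerDl sumr_ge0// => l _.
by rewrite sumr_ge0// => ? _; exact: norm1_ge0.
Qed.
Lemma mxnorm1_part A b i j : `|part b (A i j)| <= mxnorm1 A.
Proof.
rewrite /mxnorm1 (bigD1 i)//= (bigD1 j)//=.
rewrite -addrA; apply: (@le_trans _ _ (norm1 (A i j))).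
  by rewrite /norm1; case: b; rewrite ?lerDl ?lerDr.
rewrite lerDl addr_ge0 ?sumr_ge0//= => *; rewrite ?norm1_ge0//.
by rewrite sumr_ge0// => *; rewrite norm1_ge0.
Qed.
(** The constant counts the real coordinates. With [mxnorm1_part] this moves bounds between matrices
    and scalar functions. *)
Lemma mxnorm1_le A c : (forall b i j, `|part b (A i j)| <= c) ->
  mxnorm1 A <= (n * n * 2)%:R * c.
Proof.
move=> h; rewrite /mxnorm1 !natrM -!mulrA.
have -> : n%:R * (n%:R * (2%:R * c)) = \sum_(i < n) \sum_(j < n) (2%:R * c).
  by rewrite !sumr_const !card_ord !mulr_natl.
rewrite ler_sum// => i _; rewrite ler_sum// => j _.
by rewrite mulr_natl mulr2n lerD.
Qed.

Lemma scale_mulmxl c A B : (c *: A) * B = c *: (A * B).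
Proof. by rewrite -!mulmxE -scalemxAl. Qed.
Lemma scale_mulmxr c A B : A * (c *: B) = c *: (A * B).
Proof. by rewrite -!mulmxE -scalemxAr. Qed.

Lemma modC_ge0 z : 0 <= modC z.
Proof. exact: sqrtr_ge0. Qed.
Lemma modC_le_norm1 z : modC z <= norm1 z.
Proof.
rewrite -(ler_pXn2r (_ : (0 < 2)%N)) ?nnegrE ?modC_ge0 ?norm1_ge0//.
rewrite sqr_sqrtr ?addr_ge0 ?sqr_ge0// /norm1 /=.
rewrite -(real_normK (num_real (complex.Re z))) -(real_normK (num_real (complex.Im z))).
by rewrite sqrrD -addrA addrCA lerDr// mulrn_wge0// mulr_ge0.
Qed.

Lemma sqr_sum_le (I : finType) (F : I -> R) : (forall i, 0 <= F i) ->
  \sum_i F i ^+ 2 <= (\sum_i F i) ^+ 2.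
Proof.
move=> F0; rewrite [leRHS]expr2 mulr_suml ler_sum// => i _.
rewrite expr2 ler_wpM2l// (bigD1 i)//= lerDl sumr_ge0//.
Qed.

(** The entries of a unit vector have modulus at most 1, hence [norm1] at most 2, and the Euclidean
    norm of [A *m v] is at most the sum of the moduli of its entries. *)
Lemma opnorm_le A : opnorm A <= 2 * mxnorm1 A.
Proof.
have N0 := mxnorm1_ge0 A.
rewrite /opnorm; set S := (X in sup X).
(* For [n = 0] there is no unit vector, and [sup] takes its default value [0]. *)
have [->|S0] := eqVneq S set0; first by rewrite sup0 mulr_ge0.
apply: ge_sup; first exact/set0P.
move=> _ [v /= v1 <-].
have vk k : norm1 (v k 0) <= 2.
  have : modC (v k 0) <= 1.
    rewrite -(ler_pXn2r (_ : (0 < 2)%N)) ?nnegrE ?modC_ge0// expr1n.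
    have : vnorm v ^+ 2 = 1 by rewrite v1 expr1n.
    rewrite sqr_sqrtr; last by apply: sumr_ge0 => *; exact: sqr_ge0.
    move=> <-; rewrite (bigD1 k)//= lerDl; apply: sumr_ge0 => *; exact: sqr_ge0.
  move=> m1; have p b : `|part b (v k 0)| <= 1.
    rewrite -(ler_pXn2r (_ : (0 < 2)%N)) ?nnegrE// expr1n real_normK ?num_real//.
    apply: le_trans (_ : modC (v k 0) ^+ 2 <= _); last first.
      by rewrite -(expr1n _ 2%N) ler_pXn2r ?nnegrE ?modC_ge0.
    by rewrite sqr_sqrtr ?addr_ge0 ?sqr_ge0//; case: b; rewrite ?lerDl ?lerDr sqr_ge0.
  by rewrite /norm1 (_ : 2 = 1 + 1)// lerD.
apply: (@le_trans _ _ (\sum_i modC ((A *m v) i 0))).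
  rewrite -(ler_pXn2r (_ : (0 < 2)%N)) ?nnegrE ?sqrtr_ge0//; last first.
    by apply: sumr_ge0 => *; exact: modC_ge0.
  rewrite sqr_sqrtr; last by apply: sumr_ge0 => *; exact: sqr_ge0.
  by apply: sqr_sum_le => *; exact: modC_ge0.
rewrite mulrC /mxnorm1 mulr_suml; apply: ler_sum => i _.
apply: le_trans (modC_le_norm1 _) _; rewrite mxE.
apply: le_trans (norm1_sum _ _ _ _) _; rewrite mulr_suml ler_sum// => k _.
by apply: le_trans (norm1M _ _) _; rewrite ler_wpM2l ?norm1_ge0.
Qed.

Definition mx_continuous (F : R -> 'M[R[i]]_n) :=
  forall b i j, continuous (fun t => part b (F t i j)).

Lemma mx_is_deriveP (W : R -> 'M[R[i]]_n) t D :
  mx_is_derive W t D <->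
  forall b i j, is_derive t 1 (fun s => part b (W s i j)) (part b (D i j)).
Proof.
split=> [h [] i j|h i j]; [exact: (h i j).1|exact: (h i j).2|].
by split; [exact: (h true)|exact: (h false)].
Qed.

Lemma mx_is_derive_cst A t : mx_is_derive (fun=> A) t 0.
Proof.
by apply/mx_is_deriveP => b i j; rewrite mxE part0; exact: is_derive_cst.
Qed.

Lemma mx_is_deriveD (V W : R -> 'M[R[i]]_n) t DV DW :
  mx_is_derive V t DV -> mx_is_derive W t DW ->
  mx_is_derive (fun s => V s + W s) t (DV + DW).
Proof.
move=> /mx_is_deriveP hV /mx_is_deriveP hW; apply/mx_is_deriveP => b i j.
rewrite mxE partD.
have -> : (fun s => part b ((V s + W s) i j)) =
   (fun s => part b (V s i j)) + (fun s => part b (W s i j)).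
  by apply/funext => s; rewrite mxE partD.
exact: is_deriveD.
Qed.

Lemma mx_is_deriveM (V W : R -> 'M[R[i]]_n) t DV DW :
  mx_is_derive V t DV -> mx_is_derive W t DW ->
  mx_is_derive (fun s => V s * W s) t (DV * W t + V t * DW).
Proof.
move=> /mx_is_deriveP hV /mx_is_deriveP hW; apply/mx_is_deriveP => b i j.
have prodE b1 b2 k : is_derive t 1
    (fun s => part b1 (V s i k) * part b2 (W s k j))
    (part b1 (V t i k) * part b2 (DW k j) + part b2 (W t k j) * part b1 (DV i k)).
  exact: (@is_deriveM _ _ (fun s => part b1 (V s i k)) (fun s => part b2 (W s k j))).
rewrite -mulmxE !mxE partD !part_sum -big_split /=.
have -> : (fun s => part b ((V s *m W s) i j)) =
   \sum_k (fun s => part b (V s i k * W s k j)).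
  apply/funext => s; rewrite fct_sumE mxE part_sum; apply: eq_bigr => k _ //.
apply: is_derive_sum => k.
under eq_fun do rewrite partM.
case: b.
- have h := is_deriveB (prodE true true k) (prodE false false k).
  by apply: (is_derive_eq h); rewrite !partM; ring.
- have h := is_deriveD (prodE true false k) (prodE false true k).
  by apply: (is_derive_eq h); rewrite !partM; ring.
Qed.

Lemma mx_is_derive_continuous (W D : R -> 'M[R[i]]_n) :
  (forall t, mx_is_derive W t (D t)) -> mx_continuous W.
Proof.
move=> h b i j t; have /mx_is_deriveP /(_ b i j) := h t.
by move=> [+ _] => /derivable1_diffP/differentiable_continuous.
Qed.

End Matrices.

(** * Real calculus: primitives, mean value bounds, power series *)

Section RealAnalysis.
Context {R : realType}.
Implicit Types (f : R -> R) (t : R).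

Lemma oint0 f : oint f 0 = 0.
Proof. by rewrite /oint lexx set_itv1 Rintegral_set1. Qed.

(** [oint] is defined by cases at [0]. Near [t] both cases equal [F x - F 0], where [F] integrates
    from a base point [a] to the left of [0] and [t], and the fundamental theorem applies to [F]. *)
Lemma is_derive_oint f t : continuous f -> is_derive t 1 (oint f) (f t).
Proof.
move=> cf; pose a := - (`|t| + 1).
have a0 : a < 0 by rewrite oppr_lt0 ltr_wpDl.
have at_ : a < t.
  by rewrite ltrNl (le_lt_trans (_ : _ <= `|t|)) ?ltrDl// -normrN ler_norm.
have intf x y : lebesgue_measure.-integrable `[x, y] (EFin \o f).
  apply: continuous_compact_integrable; first exact: segment_compact.
  exact/continuous_subspaceT.
have split x y z : x <= y -> y <= z -> Rintegral lebesgue_measure `[x, z] f =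
   Rintegral lebesgue_measure `[x, y] f + Rintegral lebesgue_measure `[y, z] f.
  move=> xy yz; have := @Rintegral_itvB R f (BLeft x) (BRight z) y (intf x z).
  rewrite !bnd_simp => /(_ xy yz) h.
  rewrite -(@Rintegral_itv_obnd_cbnd _ y (BRight z)); first by rewrite -h addrC subrK.
  by apply: integrableS (intf y z) => //; apply: subset_itvr; rewrite bnd_simp.
pose F x := Rintegral lebesgue_measure `[a, x] f.
have [dF dFE] := @continuous_FTC1_closed R f a t (t + 1) (ltr_pwDr ltr01 (lexx _)) (intf _ _) at_ (cf t).
have hF : is_derive t 1 (fun x => F x + - F 0) (f t + 0).
  apply: is_deriveD.
  by apply: DeriveDef => //; rewrite -derive1E.
apply: near_eq_is_derive (is_derive_eq hF (addr0 _)).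
near=> x.
have ax : a < x by near: x; exact: lt_nbhsr.
rewrite /oint /F; case: leP => x0.
  by rewrite (split a 0 x)// ?(ltW a0)// addrC addKr.
rewrite (split a x 0)// ?(ltW x0) ?(ltW ax)//.
by rewrite opprD addrA subrr add0r.
Unshelve. all: by end_near. Qed.

Lemma MVT_bound f (df : R -> R) (c t : R) :
  (forall s : R, is_derive s 1 f (df s)) -> (forall s, `|s| <= `|t| -> `|df s| <= c) ->
  `|f t - f 0| <= c * `|t|.
Proof.
move=> h hc.
have cf : continuous f.
  by move=> s; have [+ _] := h s => /derivable1_diffP/differentiable_continuous.
have [t0|t0] := leP 0 t.
  have [s] := MVT_segment t0 (fun s _ => h s) (continuous_subspaceT cf).
  rewrite in_itv/= => /andP[s0 st] ->; rewrite subr0 normrM ler_wpM2r//.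
  by apply: hc; rewrite !ger0_norm.
have [s] := MVT_segment (ltW t0) (fun s _ => h s) (continuous_subspaceT cf).
rewrite in_itv/= => /andP[ts s0] e.
rewrite distrC e sub0r normrM normrN ler_wpM2r//.
by apply: hc; rewrite !ler0_norm ?lerN2// ltW.
Qed.

(** The triangle inequality on the block of terms from [M] to [N] passes to the limit in [N]. *)
Lemma series_norm_le (u a : nat -> R) M : (forall m, 0 <= a m) -> cvgn (series a) ->
  (forall m, `|u m| <= a m) ->
  cvgn (series u) /\ `|limn (series u) - series u M| <= limn (series a) - series a M.
Proof.
move=> a0 ca ua.
have cu : cvgn (series u).
  by apply: normed_cvg; apply: series_le_cvg ca => //= m.
split=> //.
have key N : (M <= N)%N -> `|series u N - series u M| <= series a N - series a M.
  move=> MN; rewrite !sub_series_geq//.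
  by apply: le_trans (ler_norm_sum _ _ _) _; apply: ler_sum.
have c1 : (fun N => `|series u N - series u M|) @ \oo --> `|limn (series u) - series u M|.
  by apply: cvg_norm; apply: cvgB => //; exact: cvg_cst.
have c2 : (fun N => series a N - series a M) @ \oo --> limn (series a) - series a M.
  by apply: cvgB => //; exact: cvg_cst.
rewrite -(cvg_lim _ c1)// -(cvg_lim _ c2)//.
apply: ler_lim; [by apply/cvg_ex; eexists; exact: c1|by apply/cvg_ex; eexists; exact: c2|].
by near=> N; apply: key; near: N; exact: nbhs_infty_ge.
Unshelve. all: by end_near. Qed.

(** Convergence at distance [s = r / 2] bounds [c k * s ^+ k] by some [B]; closer to [t0] the terms
    are then dominated by a geometric series of ratio [q = |t - t0| / s]. *)
Lemma power_series_taylor f (c : nat -> R) (t0 r : R) (Q : nat) : 0 < r ->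
  (forall t, `|t - t0| < r -> (fun N => \sum_(k < N) c k * (t - t0) ^+ k) @ \oo --> f t) ->
  exists (K d : R), [/\ 0 <= K, 0 < d & forall t, `|t - t0| < d ->
    `|f t - \sum_(k < Q) c k * (t - t0) ^+ k| <= K * `|t - t0| ^+ Q].
Proof.
move=> r0 h.
pose s := r / 2.
have s0 : 0 < s by rewrite divr_gt0.
have [B B0 hB] : exists2 B, 0 <= B & forall k, `|c k| * s ^+ k <= B.
  have st : `|s + t0 - t0| < r by rewrite addrK gtr0_norm// /s; lra.
  have cs : cvgn (series (fun k => c k * s ^+ k)).
    apply/cvg_ex; exists (f (s + t0)); have := h _ st; rewrite addrK.
    by under eq_fun do rewrite -(big_mkord xpredT (fun k => c k * s ^+ k)).
  have [B [_ hB]] := cvg_series_bounded cs.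
  exists (`|B| + 1); first by rewrite addr_ge0.
  move=> k; have /= := hB (`|B| + 1) _ k I.
  rewrite normrM normrX (gtr0_norm s0); apply.
  by rewrite (le_lt_trans (ler_norm _))// ltrDl.
(* Within [s / 2] the ratio [q] is at most 1/2, so the geometric tail [B q^Q / (1 - q)] is at most
   [2 B q^Q]. *)
exists (B * 2 / s ^+ Q), (s / 2); split; rewrite ?divr_gt0//.
  by rewrite divr_ge0 ?mulr_ge0// exprn_ge0// ltW.
move=> t ht; set x := t - t0 in ht *.
have xr : `|x| < r by rewrite (lt_le_trans ht)// /s; lra.
pose q := `|x| / s.
have q0 : 0 <= q by rewrite divr_ge0// ltW.
have q2 : q <= 2^-1 by rewrite ler_pdivrMr// mulrC ltW.
pose a k := B * q ^+ k.
have a0 k : 0 <= a k by rewrite mulr_ge0 ?exprn_ge0.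
have q1 : `|q| < 1 by rewrite ger0_norm// (le_lt_trans q2)// invf_lt1// ltr1n.
have ca := @cvg_geometric_series _ B _ q1.
have ua k : `|c k * x ^+ k| <= a k.
  rewrite normrM normrX /a /q expr_div_n mulrA ler_pdivlMr ?exprn_gt0//.
  by rewrite mulrAC ler_wpM2r ?exprn_ge0.
have [cu] := @series_norm_le (fun k => c k * x ^+ k) a Q a0 (cvgP _ ca) ua.
have -> : limn (series (fun k => c k * x ^+ k)) = f t.
  apply: cvg_lim => //; have := h _ xr.
  by under eq_fun do rewrite -(big_mkord xpredT (fun k => c k * x ^+ k)).
rewrite {1}/series /= big_mkord => /le_trans; apply.
have -> : limn (series a) = B * (1 - q)^-1 by exact: cvg_lim ca.
have q1' : q != 1 by rewrite lt_eqF// (le_lt_trans q2)// invf_lt1// ltr1n.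
have -> : series a Q = B * (1 - q ^+ Q) / (1 - q) by rewrite (@geometric_seriesE _ B).
have -> : B * (1 - q)^-1 - B * (1 - q ^+ Q) / (1 - q) = B * q ^+ Q / (1 - q).
  by rewrite -mulrBl; congr (_ / _); ring.
have -> : B * 2 / s ^+ Q * `|x| ^+ Q = B * q ^+ Q * 2.
  by rewrite /q [(`|x| / s) ^+ Q]expr_div_n; ring.
rewrite ler_wpM2l ?a0// -[leRHS]invrK lef_pV2 ?posrE ?invr_gt0//.
  by lra.
by rewrite subr_gt0 (le_lt_trans q2)// invf_lt1// ltr1n.
Qed.

(** The expansion with [Q = 1] bounds [f t - c 0] by a multiple of [|t - t0|]; at [t = t0] it
    identifies [c 0] with [f t0]. *)
Lemma real_analytic_continuous f : real_analytic f -> continuous f.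
Proof.
move=> h t0; have [r [r0 [c hc]]] := h t0.
have [K [d [K0 d0 hK]]] := power_series_taylor f c t0 r 1 r0 hc.
have E : f t0 = c 0%N.
  have := hK t0; rewrite subrr normr0 d0 => /(_ isT).
  by rewrite expr1 mulr0 big_ord1 expr0 mulr1 normr_le0 subr_eq0 => /eqP.
apply/cvgrPdist_le => e e0.
near=> t.
rewrite distrC.
have td : `|t - t0| < d.
  by near: t; apply: cvgr_distC_lt.
have := hK _ td; rewrite big_ord1 expr0 mulr1 -E expr1 => /le_trans; apply.
have td2 : `|t - t0| < e / (K + 1).
  by near: t; apply: cvgr_distC_lt => //; rewrite divr_gt0// ltr_wpDl.
apply: le_trans (_ : (K + 1) * `|t - t0| <= _).
  by rewrite ler_wpM2r// lerDl.
by rewrite mulrC -ler_pdivlMr ?ltr_wpDl// ltW.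
Unshelve. all: by end_near. Qed.

End RealAnalysis.

(** * Orders of magnitude and Taylor expansions in [al] and [t] *)

Section OrderCalculus.
Context {R : realType} {n : nat}.
Implicit Types (F G D : R -> R -> 'M[R[i]]_n) (B : R -> 'M[R[i]]_n).

(** The constants are uniform in both variables. Requiring [d <= 1] makes lower powers dominate
    higher ones, as [isO_weak] needs. *)
Definition isO (a b : nat) F := exists K d : R, [/\ 0 <= K, 0 < d, d <= 1 &
  forall al t, `|al| < d -> `|t| < d -> mxnorm1 (F al t) <= K * `|al| ^+ a * `|t| ^+ b].

Lemma eq_isO a b F G : (forall al t, F al t = G al t) -> isO a b F -> isO a b G.
Proof. by move=> e [K [d [K0 d0 d1 h]]]; exists K, d; split=> // al t; rewrite -e; exact: h. Qed.

Lemma isO_cst (A : 'M[R[i]]_n) : isO 0 0 (fun _ _ => A).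
Proof.
by exists (mxnorm1 A), 1; split=> // [|al t _ _]; rewrite ?mxnorm1_ge0// !expr0 !mulr1.
Qed.

Lemma isO0 a b : isO a b (fun _ _ => 0).
Proof. by exists 0, 1; split=> // al t _ _; rewrite mxnorm1_0 !mul0r. Qed.

Lemma isO_weak a b a' b' F : (a <= a')%N -> (b <= b')%N -> isO a' b' F -> isO a b F.
Proof.
move=> aa bb [K [d [K0 d0 d1 h]]]; exists K, d; split=> // al t ha ht.
apply: le_trans (h _ _ ha ht) _.
rewrite -!mulrA ler_wpM2l// ler_pM ?exprn_ge0//.
- by rewrite ler_wiXn2l// (le_trans (ltW ha)).
- by rewrite ler_wiXn2l// (le_trans (ltW ht)).
Qed.

Lemma isOD a b F G : isO a b F -> isO a b G -> isO a b (fun al t => F al t + G al t).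
Proof.
move=> [K [d [K0 d0 d1 h]]] [L [e [L0 e0 e1 g]]].
exists (K + L), (Num.min d e); split; rewrite ?addr_ge0 ?lt_min ?d0 ?ge_min ?d1//.
move=> al t; rewrite !lt_min => /andP[a1 a2] /andP[t1 t2].
by apply: le_trans (mxnorm1D _ _) _; rewrite !mulrDl lerD ?h ?g.
Qed.

Lemma isOZ a b (x : R) F : isO a b F -> isO a b (fun al t => x%:C *: F al t).
Proof.
move=> [K [d [K0 d0 d1 h]]]; exists (`|x| * K), d; split; rewrite ?mulr_ge0// => al t ha ht.
by rewrite mxnorm1Z -!mulrA ler_wpM2l// mulrA h.
Qed.

Lemma isON a b F : isO a b F -> isO a b (fun al t => - F al t).
Proof.
by move=> [K [d [K0 d0 d1 h]]]; exists K, d; split=> // al t ha ht; rewrite mxnorm1N h.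
Qed.

Lemma isOB a b F G : isO a b F -> isO a b G -> isO a b (fun al t => F al t - G al t).
Proof. by move=> hF hG; apply: isOD => //; exact: isON. Qed.

Lemma isOM a b a' b' F G : isO a b F -> isO a' b' G ->
  isO (a + a') (b + b') (fun al t => F al t * G al t).
Proof.
move=> [K [d [K0 d0 d1 h]]] [L [e [L0 e0 e1 g]]].
exists (K * L), (Num.min d e); split; rewrite ?mulr_ge0 ?lt_min ?d0 ?ge_min ?d1//.
move=> al t; rewrite !lt_min => /andP[a1 a2] /andP[t1 t2].
apply: le_trans (mxnorm1M _ _) _; rewrite !exprD.
apply: le_trans (ler_pM (mxnorm1_ge0 _) (mxnorm1_ge0 _) (h _ _ a1 t1) (g _ _ a2 t2)) _.
by rewrite le_eqVlt; apply/orP; left; apply/eqP; ring.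
Qed.

Lemma isO_sum a b m (F : nat -> R -> R -> 'M[R[i]]_n) :
  (forall i, (i < m)%N -> isO a b (F i)) -> isO a b (fun al t => \sum_(i < m) F i al t).
Proof.
elim: m => [|m IH] h; first by apply: eq_isO (isO0 a b) => al t; rewrite big_ord0.
have := isOD a b _ _ (IH (fun i hi => h i (ltnW hi))) (h m (ltnSn m)).
by apply: eq_isO => al t; rewrite big_ord_recr.
Qed.

Lemma isOX a b m F : isO a b F -> isO (a * m) (b * m) (fun al t => F al t ^+ m).
Proof.
move=> h; elim: m => [|m IH]; first by rewrite !muln0; exact: isO_cst.
have := isOM _ _ _ _ _ _ h IH; rewrite -!mulnS.
by apply: eq_isO => al t; rewrite exprS.
Qed.

Lemma isO_monomial a p B : isO a 0 (fun al _ => B al) ->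
  isO a p (fun al t => (t ^+ p)%:C *: B al).
Proof.
move=> [K [d [K0 d0 d1 h]]]; exists K, d; split=> // al t ha ht.
rewrite mxnorm1Z normrX mulrC ler_wpM2r ?exprn_ge0//.
by have := h al t ha ht; rewrite expr0 mulr1.
Qed.

(** The mean value theorem on each real coordinate gains one power of [t], with [al] as a
    parameter. *)
Lemma isO_primitive a b F D : (forall al t, mx_is_derive (F al) t (D al t)) ->
  (forall al, F al 0 = 0) -> isO a b D -> isO a b.+1 F.
Proof.
move=> hF F0 [K [d [K0 d0 d1 h]]].
exists ((n * n * 2)%:R * K), d; split=> // [|al t ha ht]; first by rewrite mulr_ge0.
have -> : (n * n * 2)%:R * K * `|al| ^+ a * `|t| ^+ b.+1 =
    (n * n * 2)%:R * (K * `|al| ^+ a * `|t| ^+ b * `|t|) by rewrite exprSr; ring.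
apply: mxnorm1_le => c i j.
have hd (s : R) : is_derive s 1 (fun s => part c (F al s i j)) (part c (D al s i j)).
  by have /mx_is_deriveP := hF al s; exact.
have := MVT_bound _ _ (K * `|al| ^+ a * `|t| ^+ b) t hd.
rewrite F0 mxE part0 subr0; apply=> s st.
apply: le_trans (mxnorm1_part _ _ _ _) _; apply: le_trans (h _ _ ha (le_lt_trans st ht)) _.
by rewrite ler_wpM2l ?mulr_ge0 ?exprn_ge0// lerXn2r ?nnegrE.
Qed.

(* [F = sum_(q < Q) t^(p+q) B_q(al) + O(al^a t^(p+Q))] with [B_q = O(al^a)] *)
Fixpoint taylor (Q a p : nat) F : Prop :=
  if Q is Q'.+1 then exists B, isO a 0 (fun al _ => B al) /\
    taylor Q' a p.+1 (fun al t => F al t - (t ^+ p)%:C *: B al)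
  else isO a p F.

Lemma eq_taylor Q a p F G : (forall al t, F al t = G al t) -> taylor Q a p F -> taylor Q a p G.
Proof. by move=> e; rewrite (_ : F = G)//; apply/funext => al; apply/funext => t. Qed.

Lemma taylor_isO Q a p F : taylor Q a p F -> isO a p F.
Proof.
elim: Q p F => [//|Q IH] p F [B [hB /IH h]].
have := isOD _ _ _ _ (isO_weak _ _ _ _ _ (leqnn a) (leqnSn p) h) (isO_monomial a p B hB).
by apply: eq_isO => al t; rewrite subrK.
Qed.

Lemma taylor_pred Q a p F : taylor Q.+1 a p F -> taylor Q a p F.
Proof.
elim: Q p F => [|Q IH] p F; first exact: taylor_isO.
by move=> [B [hB /IH h]]; exists B.
Qed.

(** Prepend a zero coefficient and drop the last one, so that the length stays [Q]. *)
Lemma taylor_weakS Q a p F : taylor Q a p.+1 F -> taylor Q a p F.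
Proof.
case: Q => [|Q] h; first exact: isO_weak (leqnn _) (leqnSn _) h.
exists (fun=> 0); split; first exact: isO0.
by apply: eq_taylor (taylor_pred _ _ _ _ h) => al t; rewrite scaler0 subr0.
Qed.

Lemma taylor_weak Q a p a' p' F : (a <= a')%N -> (p <= p')%N -> taylor Q a' p' F -> taylor Q a p F.
Proof.
move=> aa pp h.
have {}h : taylor Q a p' F.
  elim: Q p' {pp} F h => [|Q IH] p' F h; first exact: isO_weak aa (leqnn _) h.
  have [B [hB h']] := h; exists B; split; last exact: IH.
  exact: isO_weak aa (leqnn _) hB.
by move: pp h => /subnK<-; elim: (p' - p)%N => // k IH; rewrite addSn => /taylor_weakS.
Qed.

Lemma taylor0 Q a p : taylor Q a p (fun _ _ => 0).
Proof.
elim: Q p => [|Q IH] p; first exact: isO0.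
exists (fun=> 0); split; first exact: isO0.
by apply: eq_taylor (IH p.+1) => al t; rewrite scaler0 subr0.
Qed.

Lemma taylorD Q a p F G : taylor Q a p F -> taylor Q a p G ->
  taylor Q a p (fun al t => F al t + G al t).
Proof.
elim: Q p F G => [|Q IH] p F G; first exact: isOD.
move=> [B [hB h]] [C [hC g]]; exists (fun al => B al + C al); split; first exact: isOD.
by apply: eq_taylor (IH _ _ _ h g) => al t; rewrite scalerDr opprD addrACA.
Qed.

Lemma taylorZ Q a p (x : R) F : taylor Q a p F -> taylor Q a p (fun al t => x%:C *: F al t).
Proof.
elim: Q p F => [|Q IH] p F; first exact: isOZ.
move=> [B [hB h]]; exists (fun al => x%:C *: B al); split; first exact: isOZ.
by apply: eq_taylor (IH _ _ h) => al t; rewrite scalerBr !scalerA mulrC.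
Qed.

Lemma taylorB Q a p F G : taylor Q a p F -> taylor Q a p G ->
  taylor Q a p (fun al t => F al t - G al t).
Proof.
move=> hF /(taylorZ _ _ _ (-1)) hG; apply: eq_taylor (taylorD _ _ _ _ _ hF hG) => al t.
by rewrite rmorphN1 scaleN1r.
Qed.

Lemma taylor_sum Q a p m (F : nat -> R -> R -> 'M[R[i]]_n) :
  (forall i, (i < m)%N -> taylor Q a p (F i)) ->
  taylor Q a p (fun al t => \sum_(i < m) F i al t).
Proof.
elim: m => [|m IH] h; first by apply: eq_taylor (taylor0 Q a p) => al t; rewrite big_ord0.
have := taylorD _ _ _ _ _ (IH (fun i hi => h i (ltnW hi))) (h m (ltnSn m)).
by apply: eq_taylor => al t; rewrite big_ord_recr.
Qed.

Lemma taylor_monomial Q a p B : isO a 0 (fun al _ => B al) ->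
  taylor Q a p (fun al t => (t ^+ p)%:C *: B al).
Proof.
case: Q => [|Q] hB; first exact: isO_monomial.
by exists B; split=> //; apply: eq_taylor (taylor0 Q a p.+1) => al t; rewrite subrr.
Qed.

(** All [Q] coefficients are taken to be zero. This absorbs high-order remainders into
    expansions. *)
Lemma isO_taylor Q a p F : isO a (p + Q) F -> taylor Q a p F.
Proof.
elim: Q p F => [|Q IH] p F h; first by rewrite addn0 in h.
exists (fun=> 0); split; first exact: isO0.
apply: IH; move: h; rewrite addSnnS; apply: eq_isO => al t.
by rewrite scaler0 subr0.
Qed.

(** With leading terms [t^p B] and [t^p' C], [F G - t^(p+p') B C = (F - t^p B) G + t^p B (G - t^p'
    C)], and both products on the right start one power later. *)
Lemma taylorM Q a p a' p' F G : taylor Q a p F -> taylor Q a' p' G ->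
  taylor Q (a + a') (p + p') (fun al t => F al t * G al t).
Proof.
elim: Q p p' F G => [|Q IH] p p' F G; first exact: isOM.
move=> [B [hB h]] hG; have [C [hC g]] := hG.
exists (fun al => B al * C al); split; first exact: isOM hB hC.
have h1 := IH _ _ _ _ h (taylor_pred _ _ _ _ hG).
have h2 := IH _ _ _ _ (taylor_monomial Q _ p _ hB) g.
rewrite addSn in h1; rewrite addnS in h2.
apply: eq_taylor (taylorD _ _ _ _ _ h1 h2) => al t.
rewrite mulrBl mulrBr scale_mulmxl scale_mulmxr scale_mulmxl scalerA -rmorphM exprD.
by rewrite [t ^+ p * _]mulrC addrA subrK.
Qed.

Lemma mx_is_derive_monomial p B al t :
  mx_is_derive (fun s => (s ^+ p.+1)%:C *: ((p.+1%:R^-1 : R)%:C *: B al)) t ((t ^+ p)%:C *: B al).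
Proof.
apply/mx_is_deriveP => b i j.
under eq_fun do rewrite !mxE !partZ.
rewrite mxE partZ.
have h := is_deriveM (is_deriveX p.+1 (is_derive_id t 1))
  (is_derive_cst (p.+1%:R^-1 * part b (B al i j)) t 1).
rewrite exprfctE in h.
apply: (is_derive_eq h); rewrite scaler0 add0r /= /GRing.scale /= mulr1.
by rewrite mulrC mulrACA mulfV ?pnatr_eq0// mul1r mulrC.
Qed.

Lemma mx_is_derive_sub_monomial p F D B al t : mx_is_derive (F al) t (D al t) ->
  mx_is_derive (fun s => F al s - (s ^+ p.+1)%:C *: ((p.+1%:R^-1 : R)%:C *: B al)) t
    (D al t - (t ^+ p)%:C *: B al).
Proof.
move=> hF; have := mx_is_deriveD _ _ _ _ _ hF
  (mx_is_deriveM _ _ _ _ _ (mx_is_derive_cst (-1) t) (mx_is_derive_monomial p B al t)).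
by rewrite mul0r add0r mulN1r; under eq_fun do rewrite mulN1r.
Qed.

(** Subtracting the integrated leading monomial from [F] leaves a primitive of the remainder of [D]
    that still vanishes at [0], so the induction goes on. *)
Lemma taylor_primitive Q a p F D : (forall al t, mx_is_derive (F al) t (D al t)) ->
  (forall al, F al 0 = 0) -> taylor Q a p D -> taylor Q a p.+1 F.
Proof.
elim: Q p F D => [|Q IH] p F D hF F0; first exact: isO_primitive.
move=> [B [hB h]]; exists (fun al => (p.+1%:R^-1)%:C *: B al); split; first exact: isOZ.
apply: IH h => [al t|al]; last by rewrite F0 expr0n scale0r subr0.
exact: mx_is_derive_sub_monomial.
Qed.

Lemma adBl (X Y Z : 'M[R[i]]_n) : ad (X - Y) Z = ad X Z - ad Y Z.
Proof. by rewrite /ad mulrBl mulrBr !opprB [_ * _ - _]addrC addrACA addrC [- _ + _]addrC. Qed.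

Lemma adBr (X Y Z : 'M[R[i]]_n) : ad X (Y - Z) = ad X Y - ad X Z.
Proof. by rewrite /ad mulrBl mulrBr !opprB [_ * _ - _]addrC addrACA addrC [- _ + _]addrC. Qed.

Lemma taylor_ad Q a p a' p' F G : taylor Q a p F -> taylor Q a' p' G ->
  taylor Q (a + a') (p + p') (fun al t => ad (F al t) (G al t)).
Proof.
move=> hF hG; apply: taylorB; first exact: taylorM.
by rewrite addnC [(p + _)%N]addnC; exact: taylorM.
Qed.

(* The leading coefficients of a function and of its primitive are proportional, hence commute. *)
Lemma taylor_ad_primitive Q a p F D : (forall al t, mx_is_derive (F al) t (D al t)) ->
  (forall al, F al 0 = 0) -> taylor Q.+1 a p D ->
  taylor Q (a + a) (p + p).+2 (fun al t => ad (F al t) (D al t)).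
Proof.
move=> hF F0 hD; have [B [hB h]] := hD.
pose L al t := (t ^+ p.+1)%:C *: ((p.+1%:R^-1 : R)%:C *: B al) : 'M[R[i]]_n.
have hL : taylor Q a p.+1 L by apply: taylor_monomial; exact: isOZ.
have h1 : taylor Q a p.+2 (fun al t => F al t - L al t).
  apply: taylor_primitive h => [al t|al]; first exact: mx_is_derive_sub_monomial.
  by rewrite /L F0 expr0n scale0r subr0.
have h2 := taylor_ad _ _ _ _ _ _ _ h1 (taylor_pred _ _ _ _ hD).
rewrite addSnnS in h2.
(* Since [L] commutes with [t^p B], [[F, D] = [L, D - t^p B] + [F - L, D]], and each summand starts
   at [t^(2p+2)]. *)
have := taylorD _ _ _ _ _ (taylor_ad _ _ _ _ _ _ _ hL h) h2.
rewrite addnS !addSn; apply: eq_taylor => al t.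
have LB : ad (L al t) ((t ^+ p)%:C *: B al) = 0.
  rewrite /ad /L !(scale_mulmxl, scale_mulmxr) !scalerA.
  by apply/eqP; rewrite subr_eq0; apply/eqP; congr (_ *: _); ring.
by rewrite adBr LB subr0 adBl addrC subrK.
Qed.

End OrderCalculus.

(** * Polynomial identities for truncated exponentials *)

Section TruncatedExponential.
Context {R : realType} {n : nat}.
Implicit Types (X A B : 'M[R[i]]_n) (M d m : nat).

Definition invfact m : R[i] := (m`!%:R)^-1.

(** Turns binomial sums divided by [d!] into Cauchy products of exponential coefficients. *)
Lemma invfact_bin d m : (m <= d)%N -> invfact d * 'C(d, m)%:R = invfact m * invfact (d - m).
Proof.
move=> md; rewrite /invfact -(bin_fact md) !natrM.
have f0 j : (j`!%:R : R[i]) != 0 by rewrite pnatr_eq0 -lt0n fact_gt0.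
have c0 : ('C(d, m)%:R : R[i]) != 0 by rewrite pnatr_eq0 -lt0n bin_gt0.
by field; rewrite c0 !f0.
Qed.

Definition expT M X := \sum_(k < M) invfact k *: X ^+ k.

(* [sum_(i <= d) X^i A X^(d-i)], the differential of [X ^+ d.+1] at [A] *)
Fixpoint dpow d X A := if d is d'.+1 then dpow d' X A * X + X ^+ d * A else A.

Lemma mx_is_derive_pow (X : R -> 'M[R[i]]_n) t A d : mx_is_derive X t A ->
  mx_is_derive (fun s => X s ^+ d.+1) t (dpow d (X t) A).
Proof.
move=> h; elim: d => [|d IH] //.
under eq_fun do rewrite exprSr.
exact: mx_is_deriveM.
Qed.

Lemma mx_is_derive_sum (X : nat -> R -> 'M[R[i]]_n) D t M :
  (forall k, mx_is_derive (X k) t (D k)) ->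
  mx_is_derive (fun s => \sum_(k < M) X k s) t (\sum_(k < M) D k).
Proof.
move=> h; elim: M => [|M IH].
  by under eq_fun do rewrite big_ord0; rewrite big_ord0; exact: mx_is_derive_cst.
under eq_fun do rewrite big_ord_recr/=; rewrite big_ord_recr/=.
exact: mx_is_deriveD.
Qed.

Lemma mx_is_deriveZ (c : R[i]) (X : R -> 'M[R[i]]_n) t A : mx_is_derive X t A ->
  mx_is_derive (fun s => c *: X s) t (c *: A).
Proof.
move=> h; have := mx_is_deriveM _ _ _ _ _ (mx_is_derive_cst (c *: (1 : 'M[R[i]]_n)) t) h.
rewrite mul0r add0r scale_mulmxl mul1r.
by under eq_fun do rewrite scale_mulmxl mul1r.
Qed.

Lemma mx_is_derive_expT (X : R -> 'M[R[i]]_n) t A M : mx_is_derive X t A ->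
  mx_is_derive (fun s => expT M.+1 (X s)) t (\sum_(d < M) invfact d.+1 *: dpow d (X t) A).
Proof.
move=> h; rewrite /expT.
under eq_fun do rewrite big_ord_recl expr0.
rewrite -[\sum_(d < M) _]add0r; apply: mx_is_deriveD; first exact: mx_is_derive_cst.
apply: (@mx_is_derive_sum (fun k s => invfact k.+1 *: X s ^+ k.+1)
  (fun k => invfact k.+1 *: dpow k (X t) A)) => k.
exact/mx_is_deriveZ/mx_is_derive_pow.
Qed.

Local Notation adn m X A := (iter m (ad X) A).

Lemma mul_adn m X A : X * adn m X A = adn m.+1 X A + adn m X A * X.
Proof. by rewrite /= /ad subrK. Qed.

(** Left multiplication by [X] is [ad X] plus right multiplication by [X]. These two operators
    commute, so the [d]-th power expands binomially. *)
Lemma pow_adn d X A :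
  X ^+ d * A = \sum_(m < d.+1) adn m X A * X ^+ (d - m) *+ 'C(d, m).
Proof.
elim: d => [|d IH]; first by rewrite big_ord1 expr0 mul1r mulr1.
rewrite exprS -mulrA IH mulr_sumr.
under eq_bigr do rewrite mulrnAr mulrA mul_adn mulrDl mulrnDl.
rewrite big_split /= [RHS]big_ord_recl bin0 subn0.
under [in RHS]eq_bigr do rewrite binS mulrnDr subSS.
rewrite big_split /= [in RHS]addrA [in LHS]addrC; congr (_ + _).
rewrite big_ord_recl bin0 subn0 -mulrA -exprS; congr (_ + _).
rewrite [RHS]big_ord_recr /= bin_small// mulr0n addr0.
by apply: eq_bigr => i _; rewrite -mulrA -exprS -subSn.
Qed.

(** By Pascal's rule: the summand that [dpow] adds at each step supplies, through [pow_adn], the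
    second binomial. *)
Lemma dpow_adn d X A :
  dpow d X A = \sum_(m < d.+1) adn m X A * X ^+ (d - m) *+ 'C(d.+1, m.+1).
Proof.
elim: d => [|d IH]; first by rewrite big_ord1 expr0 mulr1.
rewrite [LHS]/= IH pow_adn.
under [in RHS]eq_bigr do rewrite binS mulrnDr.
rewrite big_split /=; congr (_ + _).
rewrite [RHS]big_ord_recr /= bin_small// mulr0n addr0 mulr_suml.
by apply: eq_bigr => i _; rewrite mulrnAl -mulrA -exprSr -subSn// -ltnS.
Qed.

(** Passes from a sum by total degree [d] to a sum by the degree [m] of the first factor; the second
    factor is then truncated at [M - m] terms. *)
Lemma sum_triangle (V : nmodType) (F : nat -> nat -> V) M :
  \sum_(d < M) \sum_(m < d.+1) F m (d - m)%N = \sum_(m < M) \sum_(l < M - m) F m l.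
Proof.
elim: M => [|M IH]; first by rewrite !big_ord0.
rewrite big_ord_recr IH /= [RHS]big_ord_recr /= subSn// subnn big_ord1.
rewrite big_ord_recr /= subnn addrA; congr (_ + _).
rewrite -big_split; apply: eq_bigr => i _ /=.
by rewrite subSn ?(ltnW (ltn_ord i))// big_ord_recr.
Qed.

(** Truncated form of two classical formulas: the derivative of [exp X] in direction [A] is
    [sum_m ad^m(A)/(m+1)!] times [exp X], and [exp X A] is [sum_m ad^m(A)/m!] times [exp X].
    Truncating by total degree keeps the identity exact, at the price of the factors
    [expT (M - m) X]. *)
Lemma dexpT_adn M X A :
  \sum_(d < M) invfact d.+1 *: dpow d X A - expT M X * A =
  \sum_(m < M) ((invfact m.+1 - invfact m) *: adn m X A) * expT (M - m) X.
Proof.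
have -> : \sum_(m < M) ((invfact m.+1 - invfact m) *: adn m X A) * expT (M - m) X =
   \sum_(m < M) \sum_(l < M - m)
     ((invfact m.+1 - invfact m) *: adn m X A) * (invfact l *: X ^+ l).
  by apply: eq_bigr => i _; rewrite mulr_sumr.
rewrite -(sum_triangle _ (fun m l => ((invfact m.+1 - invfact m) *: adn m X A) * (invfact l *: X ^+ l))).
rewrite mulr_suml -sumrB; apply: eq_bigr => d _.
rewrite scale_mulmxl dpow_adn pow_adn !scaler_sumr -sumrB; apply: eq_bigr => m _.
rewrite -[X in _ *: X - _]scaler_nat -[X in _ - _ *: X]scaler_nat !scalerA -scalerBl.
rewrite scale_mulmxl scale_mulmxr scalerA; congr (_ *: _).
rewrite !invfact_bin//; last by rewrite -ltnS.
by rewrite subSS -mulrBl.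
Qed.

(** The part of total degree [d] is [(X - X)^d / d!] by the binomial theorem, which vanishes for
    [d > 0]. *)
Lemma expTN M X : \sum_(m < M.+1) (invfact m *: X ^+ m) * expT (M.+1 - m) (- X) = 1.
Proof.
under eq_bigr do rewrite mulr_sumr.
rewrite -(sum_triangle _ (fun m l => (invfact m *: X ^+ m) * (invfact l *: (- X) ^+ l))).
rewrite big_ord_recl big_ord1 big1 ?addr0 => [|d _].
  by rewrite /invfact invr1 !expr0 !scale1r mulr1.
have cX : GRing.comm (- X) X by rewrite /GRing.comm mulNr mulrN.
have : (- X + X) ^+ d.+1 = 0 by rewrite addNr expr0n.
rewrite (exprDn_comm _ cX).
move=> /(congr1 (fun Y : 'M[R[i]]_n => invfact d.+1 *: Y)); rewrite scaler0 => h.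
rewrite -[RHS]h scaler_sumr; apply: eq_bigr => m _.
rewrite -[X in _ = _ *: X]scaler_nat scalerA invfact_bin; last by rewrite -ltnS.
rewrite scale_mulmxl scale_mulmxr scalerA; congr (_ *: _).
exact/esym/commrX/commr_sym/commrX/commr_sym.
Qed.

End TruncatedExponential.

(** * Tails and continuity of matrix series *)

Section MatrixSeries.
Context {R : realType} {n : nat}.
Implicit Types (u : nat -> 'M[R[i]]_n) (F G : R -> 'M[R[i]]_n).

Local Notation adn m X A := (iter m (ad X) A).

Lemma part_mxseries u b i j :
  part b (mxseries u i j) = limn (series (fun k => part b (u k i j))).
Proof.
rewrite mxE /seriesC /limC.
have -> : series (fun k => part b (u k i j)) =
    fun N => part b (\sum_(k < N) u k i j).
  by apply/funext => N; rewrite part_sum /series/= big_mkord.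
by case: b.
Qed.

Lemma mxseries_tail u (a : nat -> R) M : (forall m, 0 <= a m) -> cvgn (series a) ->
  (forall m, mxnorm1 (u m) <= a m) ->
  mxnorm1 (mxseries u - \sum_(m < M) u m) <=
    (n * n * 2)%:R * (limn (series a) - series a M).
Proof.
move=> a0 ca ua; apply: mxnorm1_le => b i j.
have [|_] := series_norm_le (fun m => part b (u m i j)) a M a0 ca.
  by move=> m; apply: le_trans (ua m); exact: mxnorm1_part.
apply: le_trans; rewrite !mxE partD partN -part_mxseries summxE part_sum.
by rewrite /series /= big_mkord mxE.
Qed.

Lemma mxseries_exp_tail u (c x : R) M : 0 <= c -> 0 <= x ->
  (forall m, mxnorm1 (u m) <= c * (x ^+ m / m`!%:R)) ->
  mxnorm1 (mxseries u - \sum_(m < M) u m) <=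
    (n * n * 2)%:R * (c * (expR x - series (exp_coeff x) M)).
Proof.
move=> c0 x0 h.
have ca : cvgn (series (c *: exp_coeff x)) by apply: is_cvg_seriesZ; exact: is_cvg_series_exp_coeff.
have := mxseries_tail u (c *: exp_coeff x) M _ ca h.
rewrite lim_seriesZ; last exact: is_cvg_series_exp_coeff.
rewrite seriesZ -scalerBr; apply=> m.
by rewrite mulr_ge0// divr_ge0// exprn_ge0.
Qed.

(** For [m >= M] the term [x^m / m!] is at most [x^M / m!], and the [1 / m!] sum to [expR 1]. *)
Lemma expR_tail_le (x : R) M : 0 <= x -> x <= 1 ->
  expR x - series (exp_coeff x) M <= x ^+ M * expR 1.
Proof.
move=> x0 x1.
have cx := is_cvg_series_exp_coeff x.
rewrite lerBlDr; apply: limr_le; first exact: cx.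
near=> N.
have MN : (M <= N)%N by near: N; exact: nbhs_infty_ge.
rewrite -lerBlDr sub_series_geq//.
apply: (@le_trans _ _ (x ^+ M * series (exp_coeff 1) N)).
  rewrite /series /= [in leRHS](big_cat_nat (n := M))//= mulrDr mulr_sumr.
  rewrite [in leRHS]mulr_sumr ler_wpDl ?sumr_ge0// => [m _|].
    by rewrite mulr_ge0 ?exprn_ge0// divr_ge0 ?expr1n.
  rewrite big_nat_cond [leRHS]big_nat_cond; apply: ler_sum => m /andP[/andP[Mm _] _].
  rewrite /exp_coeff /= expr1n mulrA mulr1 ler_wpM2r ?invr_ge0//.
  by rewrite ler_wiXn2l.
rewrite ler_wpM2l ?exprn_ge0//.
apply: nondecreasing_cvgn_le; last exact: is_cvg_series_exp_coeff.
apply: nondecreasing_series => m _ _; rewrite /exp_coeff/= divr_ge0 ?expr1n//.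
Unshelve. all: by end_near. Qed.

Lemma isO_mxseries (u : nat -> R -> R -> 'M[R[i]]_n) (X Y : R -> R -> 'M[R[i]]_n) M :
  (forall m al t, mxnorm1 (u m al t) <=
     mxnorm1 (Y al t) * ((2 * mxnorm1 (X al t)) ^+ m / m`!%:R)) ->
  isO 1 1 X -> isO 0 0 Y ->
  isO M M (fun al t => mxseries (fun m => u m al t) - \sum_(m < M) u m al t).
Proof.
move=> h [K [d [K0 d0 d1 hX]]] [L [e [L0 e0 e1 hY]]].
have K1 : 0 < 2 * K + 1 by rewrite ltr_wpDl// mulr_ge0.
exists ((n * n * 2)%:R * (L * (2 * K) ^+ M * expR 1)).
(* The third radius forces [x = 2 * mxnorm1 (X al t)] to be at most 1, as [expR_tail_le]
   requires. *)
exists (Num.min (Num.min d e) (2 * K + 1)^-1); split.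
- by rewrite !mulr_ge0 ?exprn_ge0 ?mulr_ge0 ?expR_ge0.
- by rewrite !lt_min d0 e0 invr_gt0.
- by rewrite !ge_min d1.
move=> al t; rewrite !lt_min => /andP[/andP[a1 a2] a3] /andP[/andP[t1 t2] t3].
have hx := hX _ _ a1 t1; rewrite !expr1 in hx.
have hy := hY _ _ a2 t2; rewrite !expr0 !mulr1 in hy.
set x := 2 * mxnorm1 (X al t).
have x0 : 0 <= x by rewrite mulr_ge0 ?mxnorm1_ge0.
have xle : x <= 2 * K * (`|al| * `|t|) by rewrite -mulrA ler_wpM2l// mulrA.
have x1 : x <= 1.
  apply: le_trans xle _; apply: (@le_trans _ _ (2 * K * (1 * (2 * K + 1)^-1))).
    rewrite ler_wpM2l ?mulr_ge0// ler_pM//; last exact: ltW.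
    by rewrite (le_trans (ltW a1)).
  by rewrite mul1r ler_pdivrMr// mul1r lerDl.
apply: le_trans (mxseries_exp_tail _ _ x M (mxnorm1_ge0 (Y al t)) x0 (fun m => h m al t)) _.
rewrite -!mulrA ler_wpM2l//.
apply: le_trans (_ : L * (x ^+ M * expR 1) <= _).
  apply: ler_pM; rewrite ?mxnorm1_ge0//; last exact: expR_tail_le.
  rewrite subr_ge0; apply: nondecreasing_cvgn_le; last exact: is_cvg_series_exp_coeff.
  by apply: nondecreasing_series => m _ _; rewrite /exp_coeff/= divr_ge0 ?exprn_ge0.
rewrite ler_wpM2l// [leRHS]mulrCA [leRHS]mulrC ler_wpM2r ?expR_ge0//.
by rewrite -!exprMn lerXn2r ?nnegrE// !mulr_ge0.
Qed.

Lemma mx_continuousD F G : mx_continuous F -> mx_continuous G ->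
  mx_continuous (fun t => F t + G t).
Proof.
move=> hF hG b i j t; under eq_fun do rewrite mxE partD.
by apply: continuousD; [exact: hF|exact: hG].
Qed.

Lemma mx_continuous_cst (A : 'M[R[i]]_n) : mx_continuous (fun=> A).
Proof. by move=> b i j; exact: cst_continuous. Qed.

Lemma continuous_sum_fun m (f : 'I_m -> R -> R) :
  (forall k, continuous (f k)) -> continuous (fun t => \sum_k f k t).
Proof.
move=> h t; apply: cvg_big => [|k _]; [exact: add_continuous|exact: h].
Qed.

Lemma mx_continuousM F G : mx_continuous F -> mx_continuous G ->
  mx_continuous (fun t => F t * G t).
Proof.
move=> hF hG b i j.
have -> : (fun t => part b ((F t * G t) i j)) =
    fun t => \sum_k part b (F t i k * G t k j).
  by apply/funext => t; rewrite -mulmxE mxE part_sum.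
apply: continuous_sum_fun => k t.
under eq_fun do rewrite partM.
by case: b; [apply: cvgB|apply: cvgD]; apply: cvgM; do ?[exact: hF|exact: hG].
Qed.

Lemma mx_continuousZ (c : R[i]) F : mx_continuous F -> mx_continuous (fun t => c *: F t).
Proof.
move=> hF; have := mx_continuousM _ _ (mx_continuous_cst (c *: (1 : 'M[R[i]]_n))) hF.
by under eq_fun do rewrite scale_mulmxl mul1r.
Qed.

Lemma mx_continuousN F : mx_continuous F -> mx_continuous (fun t => - F t).
Proof. by move=> /(mx_continuousZ (-1)); under eq_fun do rewrite scaleN1r. Qed.

Lemma mx_continuous_sum m (F : nat -> R -> 'M[R[i]]_n) :
  (forall k, mx_continuous (F k)) -> mx_continuous (fun t => \sum_(k < m) F k t).
Proof.
move=> h; elim: m => [|m IH].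
  by under eq_fun do rewrite big_ord0; exact: mx_continuous_cst.
by under eq_fun do rewrite big_ord_recr; exact: mx_continuousD.
Qed.

Lemma mx_continuous_adn m F G : mx_continuous F -> mx_continuous G ->
  mx_continuous (fun t => adn m (F t) (G t)).
Proof.
move=> hF hG; elim: m => [//|m IH]; rewrite /= /ad.
apply: mx_continuousD; last apply: mx_continuousN; exact: mx_continuousM.
Qed.

Lemma continuous_mxnorm1 F : mx_continuous F -> continuous (fun t => mxnorm1 (F t)).
Proof.
move=> hF; do 2!apply: continuous_sum_fun => ?.
by move=> t; rewrite /norm1; apply: cvgD; apply: cvg_norm; exact: hF.
Qed.

(** A uniform limit argument: near [t0] the norms of [X] and [Y] stay below fixed bounds, so one
    truncation order [M] is within [e / 3] of the series at every nearby point, and the truncation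
    is continuous. *)
Lemma mx_continuous_series (u : nat -> R -> 'M[R[i]]_n) (X Y : R -> 'M[R[i]]_n) :
  (forall m t, mxnorm1 (u m t) <=
     mxnorm1 (Y t) * ((2 * mxnorm1 (X t)) ^+ m / m`!%:R)) ->
  (forall m, mx_continuous (u m)) -> mx_continuous X -> mx_continuous Y ->
  mx_continuous (fun t => mxseries (u ^~ t)).
Proof.
move=> h hu hX hY b i j t0; apply/cvgrPdist_le => e e0.
pose c := mxnorm1 (Y t0) + 1; pose x := 2 * (mxnorm1 (X t0) + 1).
have c0 : 0 <= c by rewrite addr_ge0 ?mxnorm1_ge0.
have x0 : 0 <= x by rewrite mulr_ge0 ?addr_ge0 ?mxnorm1_ge0.
pose T M := (n * n * 2)%:R * (c * (expR x - series (exp_coeff x) M)).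
have T0 : T M @[M --> \oo] --> 0.
  rewrite /T -(mulr0 (n * n * 2)%:R) -(mulr0 c) -(subrr (expR x)).
  apply: cvgM; first exact: cvg_cst.
  apply: cvgM; first exact: cvg_cst.
  by apply: cvgB; [exact: cvg_cst|exact: is_cvg_series_exp_coeff].
have e3 : 0 < e / 3 by rewrite divr_gt0.
have [M _ /(_ M (leqnn M))/= TM] := cvgr0_norm_lt _ T0 _ e3.
have close t : mxnorm1 (Y t) <= c -> 2 * mxnorm1 (X t) <= x ->
    `|part b (mxseries (u ^~ t) i j) - part b ((\sum_(m < M) u m t) i j)| < e / 3.
  move=> hc hx; rewrite -partN -partD.
  have -> : mxseries (u ^~ t) i j - (\sum_(m < M) u m t) i j =
            (mxseries (u ^~ t) - \sum_(m < M) u m t) i j by rewrite !mxE.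
  apply: le_lt_trans (mxnorm1_part _ _ _ _) (le_lt_trans _ (le_lt_trans (ler_norm _) TM)).
  apply: mxseries_exp_tail => // m; apply: le_trans (h m t) _.
  rewrite ler_pM ?mxnorm1_ge0// ?mulr_ge0 ?invr_ge0 ?exprn_ge0 ?mulr_ge0 ?mxnorm1_ge0//.
  rewrite ler_wpM2r ?invr_ge0//; apply: lerXn2r => //.
  by rewrite nnegrE mulr_ge0 ?mxnorm1_ge0.
near=> t.
have hc : mxnorm1 (Y t) <= c.
  apply: ltW; near: t; apply: cvgr_lt; [exact: continuous_mxnorm1|by rewrite ltrDl].
have hx : 2 * mxnorm1 (X t) <= x.
  rewrite ler_wpM2l//; apply: ltW; near: t.
  by apply: cvgr_lt; [exact: continuous_mxnorm1|rewrite ltrDl].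
have hs : `|part b ((\sum_(m < M) u m t0) i j) - part b ((\sum_(m < M) u m t) i j)| < e / 3.
  near: t; apply: cvgr_dist_lt => //.
  exact: (mx_continuous_sum M u hu b i j t0).
have hc0 : mxnorm1 (Y t0) <= c by rewrite lerDl.
have hx0 : 2 * mxnorm1 (X t0) <= x by rewrite ler_wpM2l// lerDl.
have := close t hc hx; have := close t0 hc0 hx0; move: hs.
rewrite !ltr_norml ler_norml => /andP[? ?] /andP[? ?] /andP[? ?].
by apply/andP; split; lra.
Unshelve. all: by end_near. Qed.

Lemma mxint0 F : mxint F 0 = 0.
Proof. by apply/matrixP => i j; rewrite !mxE !oint0. Qed.

Lemma mx_is_derive_mxint F t : mx_continuous F -> mx_is_derive (mxint F) t (F t).
Proof.
move=> hF; apply/mx_is_deriveP => b i j.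
have := is_derive_oint _ t (hF b i j).
by under [X in _ -> is_derive _ _ X _]eq_fun do rewrite mxE; case: b.
Qed.

Lemma mxnorm1_ad (X A : 'M[R[i]]_n) : mxnorm1 (ad X A) <= 2 * mxnorm1 X * mxnorm1 A.
Proof.
apply: le_trans (mxnorm1B _ _) _.
by have := mxnorm1M X A; have := mxnorm1M A X; lra.
Qed.

Lemma mxnorm1_adn (X A : 'M[R[i]]_n) m :
  mxnorm1 (adn m X A) <= mxnorm1 A * (2 * mxnorm1 X) ^+ m.
Proof.
elim: m => [|m IH]; first by rewrite mulr1.
apply: le_trans (mxnorm1_ad _ _) _; rewrite exprS mulrCA.
by rewrite ler_wpM2l ?mulr_ge0 ?mxnorm1_ge0.
Qed.

Lemma mxnorm1X (X : 'M[R[i]]_n) m : mxnorm1 (X ^+ m) <= mxnorm1 (1 : 'M[R[i]]_n) * mxnorm1 X ^+ m.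
Proof.
elim: m => [|m IH]; first by rewrite mulr1.
rewrite exprSr [_ ^+ m.+1]exprSr mulrA; apply: le_trans (mxnorm1M _ _) _.
by rewrite ler_wpM2r ?mxnorm1_ge0.
Qed.

Lemma invfactE m : invfact m = (m`!%:R^-1 : R)%:C.
Proof. by rewrite /invfact fmorphV rmorph_nat. Qed.

(** The factor 2 gives the same form of majorant as for the commutator series, so [isO_mxseries]
    covers both. *)
Lemma mxnorm1_exp_term (X : 'M[R[i]]_n) m :
  mxnorm1 (invfact m *: X ^+ m) <= mxnorm1 (1 : 'M[R[i]]_n) * ((2 * mxnorm1 X) ^+ m / m`!%:R).
Proof.
rewrite invfactE mxnorm1Z ger0_norm ?invr_ge0// mulrC mulrA ler_wpM2r ?invr_ge0//.
apply: le_trans (mxnorm1X _ _) _; rewrite ler_wpM2l ?mxnorm1_ge0//.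
by rewrite lerXn2r ?nnegrE ?mulr_ge0 ?mxnorm1_ge0//; have := mxnorm1_ge0 X; lra.
Qed.

(* [1/(m+1)! - 1/m! = - m/(m+1)!]; at [X = - Omega_j], [A = - A_j] the signs turn this into the
   [m]-th term of the recursion for [A_(j+1)]. *)
Definition dexp_term m (X A : 'M[R[i]]_n) := (invfact m.+1 - invfact m) *: adn m X A.

(** The coefficient has absolute value at most [1 / m!], and each commutator costs a factor
    [2 * mxnorm1 X]. *)
Lemma mxnorm1_dexp_term (X A : 'M[R[i]]_n) m :
  mxnorm1 (dexp_term m X A) <= mxnorm1 A * ((2 * mxnorm1 X) ^+ m / m`!%:R).
Proof.
rewrite /dexp_term !invfactE -rmorphB mxnorm1Z mulrA mulrC.
apply: ler_pM; rewrite ?mxnorm1_ge0 ?mxnorm1_adn//.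
have : (m.+1`!%:R^-1 : R) <= m`!%:R^-1.
  by rewrite lef_pV2 ?posrE ?ltr0n ?fact_gt0// ler_nat factS leq_pmull.
have : 0 <= (m.+1`!%:R^-1 : R) by rewrite invr_ge0.
by move=> ? ?; rewrite ler0_norm; lra.
Qed.

End MatrixSeries.

(** * Truncation errors *)

Section Remainders.
Context {R : realType} {n : nat}.
Implicit Types (X A W : R -> R -> 'M[R[i]]_n).

Local Notation adn m X A := (iter m (ad X) A).

Lemma expT_recr M (X : 'M[R[i]]_n) : expT M.+1 X = expT M X + invfact M *: X ^+ M.
Proof. by rewrite /expT big_ord_recr. Qed.

Lemma isO_exp_term m X : isO 1 1 X -> isO m m (fun al t => invfact m *: X al t ^+ m).
Proof.
move=> hX; rewrite invfactE; apply: isOZ.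
by have := isOX _ _ m _ hX; rewrite !mul1n.
Qed.

Lemma isO_expT_sub m M X : (m <= M)%N -> isO 1 1 X ->
  isO m m (fun al t => expT M (X al t) - expT m (X al t)).
Proof.
move=> /subnK <- hX; elim: (M - m)%N => [|d IH].
  by apply: eq_isO (isO0 m m) => al t; rewrite add0n subrr.
have := isOD _ _ _ _ IH (isO_weak _ _ _ _ _ (leq_addl d m) (leq_addl d m) (isO_exp_term _ _ hX)).
by apply: eq_isO => al t; rewrite addSn expT_recr addrAC.
Qed.

Lemma isO_expT M X : isO 1 1 X -> isO 0 0 (fun al t => expT M (X al t)).
Proof.
move=> hX; apply: eq_isO (isO_expT_sub 0 M _ (leq0n M) hX) => al t.
by rewrite {2}/expT big_ord0 subr0.
Qed.

Lemma taylor_dexp_term Q a p m X A : taylor Q a p (fun al t => adn m (X al t) (A al t)) ->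
  taylor Q a p (fun al t => dexp_term m (X al t) (A al t)).
Proof. by move=> h; rewrite /dexp_term !invfactE -rmorphB; exact: taylorZ. Qed.

Lemma isO_adn m X A : isO 1 1 X -> isO 0 0 A ->
  isO m m (fun al t => adn m (X al t) (A al t)).
Proof.
move=> hX hA; elim: m => [//|m IH].
(* [taylor 0] unfolds to [isO], so the commutator rule applies with no coefficients. *)
exact: (@taylor_ad _ _ 0 1 1 m m X _ hX IH).
Qed.

Lemma isO_dexp_term m X A : isO 1 1 X -> isO 0 0 A ->
  isO m m (fun al t => dexp_term m (X al t) (A al t)).
Proof. by move=> hX hA; apply: (@taylor_dexp_term 0); exact: isO_adn. Qed.

Lemma isO_dexp_tail M X A : isO 1 1 X -> isO 0 0 A ->
  isO M M (fun al t => mxseries (fun m => dexp_term m (X al t) (A al t)) -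
    \sum_(m < M) dexp_term m (X al t) (A al t)).
Proof.
move=> hX hA.
by apply: (isO_mxseries (fun m al t => dexp_term m (X al t) (A al t))) hX hA => *;
  exact: mxnorm1_dexp_term.
Qed.

Lemma isO_expm_tail M X : isO 1 1 X -> isO M M (fun al t => expm (X al t) - expT M (X al t)).
Proof.
move=> hX; apply: (isO_mxseries (fun m al t => invfact m *: X al t ^+ m)) hX (isO_cst 1).
by move=> *; exact: mxnorm1_exp_term.
Qed.

(** [expTN] is exact when the factor next to the power [m] is cut at [M.+1 - m] terms. Restoring the
    full [expT M.+1] only adds terms of total degree above [M]. *)
Lemma isO_expTNK M X : isO 1 1 X ->
  isO M M (fun al t => expT M.+1 (- X al t) * expT M.+1 (X al t) - 1).
Proof.
move=> hX; have hX' := isON _ _ _ hX.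
suff h : isO M M (fun al t => \sum_(m < M.+1) (invfact m *: (- X al t) ^+ m) *
    (expT M.+1 (X al t) - expT (M.+1 - m) (X al t))).
  apply: eq_isO h => al t.
  under eq_bigr do rewrite mulrBr.
  rewrite sumrB -mulr_suml; congr (_ - _).
  by have := expTN M (- X al t); rewrite opprK.
apply: (isO_sum _ _ _ (fun m al t => (invfact m *: (- X al t) ^+ m) *
    (expT M.+1 (X al t) - expT (M.+1 - m) (X al t)))) => m mM.
have := isOM _ _ _ _ _ _ (isO_exp_term m _ hX') (isO_expT_sub _ _ _ (leq_subr m M.+1) hX).
by rewrite subnKC ?(ltnW mM)//; apply: isO_weak.
Qed.

(** Three errors separate this from the exact [dexpT_adn]: [h1] makes all truncations [expT (M - m)]
    equal to [expT M.+1], [h2] is the top term of [expT M.+1 X * A], and [h3] is the tail of the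
    commutator series. *)
Lemma isO_dexp_remainder M X A : isO 1 1 X -> isO 0 0 A ->
  isO M M (fun al t => \sum_(d < M) invfact d.+1 *: dpow d (X al t) (A al t)
    - expT M.+1 (X al t) * A al t
    - mxseries (fun m => dexp_term m (X al t) (A al t)) * expT M.+1 (X al t)).
Proof.
move=> hX hA.
have h1 : isO M M (fun al t => \sum_(m < M) dexp_term m (X al t) (A al t) *
    (expT M.+1 (X al t) - expT (M - m) (X al t))).
  apply: (isO_sum _ _ _ (fun m al t => dexp_term m (X al t) (A al t) *
    (expT M.+1 (X al t) - expT (M - m) (X al t)))) => m mM.
  have := isOM _ _ _ _ _ _ (isO_dexp_term m _ _ hX hA)
    (isO_expT_sub _ _ _ (leq_trans (leq_subr m M) (leqnSn M)) hX).
  by rewrite subnKC ?(ltnW mM).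
have h2 := isOM _ _ _ _ _ _ (isO_exp_term M _ hX) hA.
have h3 := isOM _ _ _ _ _ _ (isO_dexp_tail M _ _ hX hA) (isO_expT M.+1 _ hX).
rewrite !addn0 in h2 h3.
have := isON _ _ _ (isOD _ _ _ _ (isOD _ _ _ _ h1 h2) h3).
apply: eq_isO => al t.
under eq_bigr do rewrite mulrBr.
rewrite sumrB -mulr_suml.
rewrite -[X in _ * _ - X](dexpT_adn M (X al t) (A al t)) mulrBl.
have -> : expT M.+1 (X al t) * A al t =
    expT M (X al t) * A al t + invfact M *: X al t ^+ M * A al t.
  by rewrite expT_recr mulrDl.
have cancel (V : zmodType) (S D E P T : V) : - (S - (D - E) + P + (T - S)) = D - (E + P) - T.
  rewrite -!addrA [S + _]addrC -!addrA addNr addr0.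
  by rewrite opprD opprK !opprD !addrA.
exact: cancel.
Qed.

End Remainders.

(** * The recursion for [A_j]: continuity and order of magnitude *)

Section Magnus.
Context {R : realType} {n : nat}.
Implicit Types (A : R -> 'M[R[i]]_n) (U : R -> R -> 'M[R[i]]_n).

Local Notation adn m X A := (iter m (ad X) A).

Lemma adnN m (X Y : 'M[R[i]]_n) : adn m (- X) (- Y) = (-1) ^+ m.+1 *: adn m X Y.
Proof.
elim: m => [|m IH]; first by rewrite expr1 scaleN1r.
rewrite /= IH /ad !(scale_mulmxl, scale_mulmxr) mulNr mulrN.
by rewrite -scalerBr [(-1) ^+ m.+2]exprS mulN1r scaleNr -scalerN opprB addrC opprK.
Qed.

(** With [negA] this forms the pair [X = - Omega_j], [A = X'] to which the derivative formula for
    the exponential is applied. *)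
Definition negOmega A j al t := - mxint (alphaA A al j) t.
Definition negA A j al t := - alphaA A al j t.

Lemma alphaAS A al j t : alphaA A al j.+1 t =
  mxseries (fun m => dexp_term m (negOmega A j al t) (negA A j al t)).
Proof.
rewrite /=; congr mxseries; apply/funext => -[|m].
  (* The term [m = 0] vanishes because [1/1! = 1/0!]. *)
  by rewrite /dexp_term subrr scale0r.
rewrite /dexp_term /negOmega /negA adnN scalerA; congr (_ *: _).
have -> : invfact m.+2 - invfact m.+1 = - (m.+1%:R / m.+2`!%:R) :> R[i].
  rewrite /invfact [m.+2`!]factS natrM.
  have f0 : (m.+1`!%:R : R[i]) != 0 by rewrite pnatr_eq0 -lt0n fact_gt0.
  have m0 : (m.+2%:R : R[i]) != 0 by rewrite pnatr_eq0.
  rewrite -(natr1 m.+1) in m0 *.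
  by field; rewrite f0 /=; move: m0; rewrite -nat1r.
by rewrite [(-1) ^+ m.+2]exprS mulN1r mulrNN [RHS]mulrC mulrA.
Qed.

(** Continuity at every [t] makes the integral of [A_j] a primitive. It passes through the recursion
    because the commutator series has a locally uniform exponential majorant. *)
Lemma alphaA_continuous A al j : mx_analytic A -> mx_continuous (alphaA A al j).
Proof.
move=> hA; elim: j => [|j IH].
  apply: mx_continuousZ => b i k.
  by have [? ?] := hA i k; case: b; exact: real_analytic_continuous.
have hX : mx_continuous (negOmega A j al).
  apply: mx_continuousN; apply: mx_is_derive_continuous => t.
  exact: mx_is_derive_mxint.
have hB : mx_continuous (negA A j al) by exact: mx_continuousN.
have -> : alphaA A al j.+1 = fun t =>
    mxseries (fun m => dexp_term m (negOmega A j al t) (negA A j al t)).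
  by apply/funext => t; rewrite alphaAS.
apply: (mx_continuous_series (fun m t => dexp_term m (negOmega A j al t) (negA A j al t)) _ _ _ _ hX hB).
  by move=> *; exact: mxnorm1_dexp_term.
by move=> m; apply: mx_continuousZ; exact: mx_continuous_adn.
Qed.

Lemma negOmega_derive A j al t : mx_analytic A -> mx_is_derive (negOmega A j al) t (negA A j al t).
Proof.
move=> hA; have := mx_is_deriveZ (-1) _ _ _ (mx_is_derive_mxint _ t (alphaA_continuous A al j hA)).
by rewrite scaleN1r; under eq_fun do rewrite scaleN1r.
Qed.

Lemma negOmega0 A j al : negOmega A j al 0 = 0.
Proof. by rewrite /negOmega mxint0 oppr0. Qed.

Lemma analytic_taylor Q A : mx_analytic A -> taylor Q 0 0 (fun _ t => A t).
Proof.
move=> hA.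
have /choice [c hc] : forall x : bool * ('I_n * 'I_n), exists c : nat -> R, exists K d : R,
   [/\ 0 <= K, 0 < d & forall t, `|t| < d ->
    `|part x.1 (A t x.2.1 x.2.2) - \sum_(k < Q) c k * t ^+ k| <= K * `|t| ^+ Q].
  move=> [b [i j]] /=.
  have : real_analytic (fun t => part b (A t i j)) by have [? ?] := hA i j; case: b.
  move=> /(_ 0) [r [r0 [c hc]]]; exists c.
  have [K [d [K0 d0 h]]] := power_series_taylor _ c 0 r Q r0 hc.
  exists K, d; split=> // t td; by have := h t; rewrite subr0; exact.
have [K /choice [d hd]] := choice hc.
pose C q : 'M[R[i]]_n := \matrix_(i, j) mkC (c (true, (i, j)) q) (c (false, (i, j)) q).
have CE b i j q : part b (C q i j) = c (b, (i, j)) q by rewrite mxE; case: b.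
pose S (t : R) := \sum_(q < Q) (t ^+ q)%:C *: C q.
have hS : taylor Q 0 0 (fun _ t => S t).
  apply: (taylor_sum _ _ _ _ (fun q _ t => (t ^+ q)%:C *: C q)) => q qQ.
  apply: (taylor_weak _ _ _ _ _ _ (leqnn 0) (leq0n q)).
  exact: (taylor_monomial _ _ _ (fun=> C q) (isO_cst (C q))).
have hR : isO 0 Q (fun _ t => A t - S t).
  (* There are finitely many real coordinates, so the sum of the constants and the least radius
     serve for all; starting the minimum at [1] ensures the radius is at most 1. *)
  exists ((n * n * 2)%:R * \sum_x K x), (\big[Num.min/1]_x d x); split.
  - by rewrite mulr_ge0// sumr_ge0// => x _; have [] := hd x.
  - by apply: (big_ind (fun z => 0 < z)) => // [x y x0 y0|x _];
      [rewrite lt_min x0|have [] := hd x].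
  - by apply: bigmin_le_id.
  - move=> al t _ ht; rewrite expr0 mulr1 -mulrA; apply: mxnorm1_le => b i j.
    have [K0 d0 h] := hd (b, (i, j)).
    have td : `|t| < d (b, (i, j)) by apply: lt_le_trans ht _; exact: bigmin_le_cond.
    have := h t td.
    have -> : \sum_(k < Q) c (b, (i, j)) k * t ^+ k = part b (S t i j).
      rewrite summxE part_sum; apply: eq_bigr => q _.
      by rewrite mxE partZ CE mulrC.
    rewrite !mxE partD partN => /le_trans; apply.
    rewrite ler_wpM2r ?exprn_ge0// (bigD1 (b, (i, j)))//= lerDl sumr_ge0// => x _.
    by have [] := hd x.
have := taylorD _ _ _ _ _ (isO_taylor Q 0 0 _ hR) hS.
by apply: eq_taylor => al t; rewrite subrK.
Qed.

(** By induction on [j] the exponents pass from [(a, p)] to [(2a, 2p + 2)]; the extra power of [t]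
    comes from the cancellation in [taylor_ad_primitive]. That lemma consumes one coefficient, so
    the induction hypothesis must hold for every [Q]. *)
Lemma alphaA_taylor A j Q : mx_analytic A ->
  taylor Q (2 ^ j) (2 ^ j.+1 - 2) (fun al t => alphaA A al j t).
Proof.
move=> hA; elim: j Q => [|j IH] Q.
  have h : isO 1 0 (fun al _ => al%:C *: (1 : 'M[R[i]]_n)).
    exists (mxnorm1 (1 : 'M[R[i]]_n)), 1; split=> // [|al t _ _]; first exact: mxnorm1_ge0.
    by rewrite mxnorm1Z mulrC expr1 mulr1.
  have := taylorM _ _ _ _ _ _ _ (taylor_monomial Q 1 0 _ h) (analytic_taylor Q _ hA).
  by apply: eq_taylor => al t; rewrite expr0 scale1r scale_mulmxl mul1r.
set a := (2 ^ j)%N in IH *; set p := (2 ^ j.+1 - 2)%N in IH *.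
have a0 : (0 < a)%N by rewrite expn_gt0.
have ea : (2 ^ j.+1 = a + a)%N by rewrite expnS mul2n addnn.
have ep : (2 ^ j.+2 - 2 = (p + p).+2)%N by rewrite /p (expnS 2 j.+1) ea; lia.
rewrite ea ep.
have hB N : taylor N a p (negA A j).
  by apply: eq_taylor (taylorZ _ _ _ (-1) _ (IH N)) => al t; rewrite rmorphN1 scaleN1r.
have dX al t := negOmega_derive A j al t hA.
have hX N : taylor N a p.+1 (negOmega A j) by apply: taylor_primitive (dX) (negOmega0 A j) (hB N).
have hX1 : isO 1 1 (negOmega A j) by apply: isO_weak (hX 0%N).
have hB0 : isO 0 0 (negA A j) by apply: isO_weak (hB 0%N).
(* Large enough for a tail of order [al^M t^M] to count as an expansion with [Q] zero
   coefficients. *)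
pose M := (a + a + ((p + p).+2 + Q))%N.
have tail : taylor Q (a + a) (p + p).+2 (fun al t => alphaA A al j.+1 t -
    \sum_(m < M) dexp_term m (negOmega A j al t) (negA A j al t)).
  apply: isO_taylor; apply: isO_weak (eq_isO _ _ _ _ _ (isO_dexp_tail M _ _ hX1 hB0)).
  - exact: leq_addr.
  - exact: leq_addl.
  - by move=> al t; rewrite alphaAS.
have head : taylor Q (a + a) (p + p).+2 (fun al t =>
    \sum_(m < M) dexp_term m (negOmega A j al t) (negA A j al t)).
  apply: (taylor_sum _ _ _ _ (fun m al t => dexp_term m (negOmega A j al t) (negA A j al t))) => m _.
  case: m => [|m].
    by apply: eq_taylor (taylor0 _ _ _) => al t; rewrite /dexp_term subrr scale0r.
  apply: taylor_dexp_term.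
  (* The first commutator has the required order; each further one multiplies by a factor of order
     [al^a t^(p+1)]. *)
  elim: m => [|m IHm]; first exact: taylor_ad_primitive (dX) (negOmega0 A j) (hB Q.+1).
  exact: taylor_weak (leq_addl a _) (leq_addl p.+1 _) (taylor_ad _ _ _ _ _ _ _ (hX Q) IHm).
have := taylorD _ _ _ _ _ tail head.
by apply: eq_taylor => al t; rewrite subrK.
Qed.

(** Let [m] be the maximum of the norm of [U al] on [[-|t|, |t|]], attained at [c]. The mean value
    bound on [U al c - 1] is at most [m / 2] for small [al] and [t], whence [m] is at most twice the
    norm of the identity. *)
Lemma isO_propagator A U : mx_analytic A ->
  (forall al, is_TOexp (fun s => al%:C *: A s) (U al)) -> isO 0 0 U.
Proof.
move=> hA hU.
have [K [d [K0 d0 d1 hK]]] := analytic_taylor 0 _ hA.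
pose N1 := mxnorm1 (1 : 'M[R[i]]_n); pose L := (n * n * 2)%:R * K.
have L0 : 0 <= L by rewrite mulr_ge0.
have N0 : 0 <= N1 by exact: mxnorm1_ge0.
have L1 : 0 < 2 * L + 1 by rewrite ltr_wpDl// mulr_ge0.
exists (2 * N1), (Num.min d (2 * L + 1)^-1); split.
- by rewrite mulr_ge0.
- by rewrite lt_min d0 invr_gt0.
- by rewrite ge_min d1.
move=> al t; rewrite !lt_min => /andP[a1 a2] /andP[t1 t2]; rewrite !expr0 !mulr1.
have [U0 dU] := hU al.
have cU : mx_continuous (U al) := mx_is_derive_continuous _ _ dU.
have tt : - `|t| <= `|t| by rewrite ge0_cp.
have [c] := EVT_max tt (continuous_subspaceT (continuous_mxnorm1 _ cU)).
rewrite in_itv/= -ler_norml => ct hc.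
set m := mxnorm1 (U al c) in hc.
have m0 : 0 <= m by exact: mxnorm1_ge0.
have tle : mxnorm1 (U al t) <= m by apply: hc; rewrite in_itv/= -ler_norml.
have : mxnorm1 (U al c - 1) <= (n * n * 2)%:R * (`|al| * K * m * `|c|).
  apply: mxnorm1_le => b i j.
  have hd (s : R) : is_derive s 1 (fun s => part b (U al s i j))
      (part b ((al%:C *: A s * U al s) i j)).
    by have /mx_is_deriveP := dU s; exact.
  have := MVT_bound _ _ (`|al| * K * m) c hd.
  rewrite U0 !mxE partD partN; apply=> s sc.
  apply: le_trans (mxnorm1_part _ _ _ _) _; rewrite scale_mulmxl mxnorm1Z -mulrA.
  rewrite ler_wpM2l//; apply: le_trans (mxnorm1M _ _) _.
  have st : `|s| <= `|t| := le_trans sc ct.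
  apply: ler_pM; rewrite ?mxnorm1_ge0//; last by apply: hc; rewrite in_itv/= -ler_norml.
  have := hK 0 s; rewrite normr0 !expr0 !mulr1; apply=> //.
  exact: le_lt_trans st t1.
have half : (n * n * 2)%:R * (`|al| * K * m * `|c|) <= m / 2.
  have -> : (n * n * 2)%:R * (`|al| * K * m * `|c|) = L * (`|al| * `|c|) * m by rewrite /L; ring.
  rewrite mulrC ler_wpM2l//.
  apply: (@le_trans _ _ (L * (1 * (2 * L + 1)^-1))).
    rewrite ler_wpM2l// ler_pM// ?(le_trans (ltW a1))//.
    by rewrite (le_trans ct)// ltW.
  rewrite mul1r ler_pdivrMr//; lra.
have := mxnorm1D (U al c - 1) 1; rewrite subrK -/m -/N1.
by move=> h1 h2; apply: le_trans tle _; lra.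
Qed.

End Magnus.

(** * Factoring the exponentials out of the propagator *)

Section Residual.
Context {R : realType} {n : nat}.
Implicit Types (A : R -> 'M[R[i]]_n) (U : R -> R -> 'M[R[i]]_n).

Lemma negOmega_isO A j : mx_analytic A -> isO 1 1 (negOmega A j).
Proof.
move=> hA; have h : isO 1 0 (negA A j).
  apply: isON; have := taylor_isO _ _ _ _ (alphaA_taylor A j 0 hA).
  by apply: isO_weak => //; rewrite expn_gt0.
exact: isO_primitive (fun al t => negOmega_derive A j al t hA) (negOmega0 A j) h.
Qed.

Lemma negA_isO A j : mx_analytic A -> isO 0 0 (negA A j).
Proof.
move=> hA; apply: isON; have := taylor_isO _ _ _ _ (alphaA_taylor A j 0 hA).
exact: isO_weak.
Qed.

Lemma expT0 M : expT M.+1 (0 : 'M[R[i]]_n) = 1.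
Proof.
rewrite /expT big_ord_recl big1 ?addr0; first by rewrite /invfact invr1 scale1r.
by move=> i _; rewrite expr0n scaler0.
Qed.

(* [exp (- Omega_(j-1)) ... exp (- Omega_0) U], with truncated exponentials *)
Fixpoint residual M A U j al t : 'M[R[i]]_n :=
  if j is j'.+1 then expT M.+1 (negOmega A j' al t) * residual M A U j' al t else U al t.

Lemma residual_ode M A U j : mx_analytic A ->
  (forall al, is_TOexp (fun s => al%:C *: A s) (U al)) ->
  [/\ isO 0 0 (residual M A U j), forall al, residual M A U j al 0 = 1 &
    exists2 r, isO M M r & forall al t, mx_is_derive (residual M A U j al) t
      (alphaA A al j t * residual M A U j al t + r al t)].
Proof.
move=> hA hU; elim: j => [|j [W0 W1 [r hr dW]]].
  split=> [|al|]; first exact: isO_propagator hU.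
    by have [] := hU al.
  exists (fun _ _ => 0); first exact: isO0.
  by move=> al t; rewrite addr0; have [_] := hU al; exact.
have hX := negOmega_isO A j hA; have hB := negA_isO A j hA.
have hG := isO_expT M.+1 _ hX.
split=> [|al|]; first exact: isOM hG W0.
  by rewrite /= W1 negOmega0 expT0 mulr1.
have h1 := isOM _ _ _ _ _ _ (isO_dexp_remainder M _ _ hX hB) W0.
have h2 := isOM _ _ _ _ _ _ hG hr.
rewrite !addn0 in h1; rewrite !add0n in h2.
refine (ex_intro2 _ _ _ (isOD _ _ _ _ h1 h2) _) => al t.
have := mx_is_deriveM _ _ _ _ _ (mx_is_derive_expT _ _ _ M (negOmega_derive A j al t hA)) (dW al t).
congr mx_is_derive; rewrite alphaAS /= !mulrBl mulrDr !mulrA addrA.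
have -> : expT M.+1 (negOmega A j al t) * negA A j al t * residual M A U j al t =
    - (expT M.+1 (negOmega A j al t) * alphaA A al j t * residual M A U j al t).
  by rewrite mulrN mulNr.
by rewrite opprK [in RHS]addrA [X in _ = X + _]addrC subrK.
Qed.

Lemma UF_isO A k : mx_analytic A -> isO 0 0 (fun al t => UF A al k t).
Proof.
move=> hA; elim: k => [|k IH].
  by apply: eq_isO (isO_cst 1) => al t; rewrite /UF big_ord0.
have hO := isON _ _ _ (negOmega_isO A k hA).
(* At truncation order [0] the tail is the whole series, so the tail bound says that [expm] is
   bounded. *)
have hE := isOD _ _ _ _ (isO_expm_tail 0 _ hO) (isO_expT 0 _ hO).
apply: eq_isO (isOM _ _ _ _ _ _ IH hE) => al t.
by rewrite subrK /negOmega opprK /UF big_ord_recr.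
Qed.

(** Each step inserts [expm Omega_k * expT (- Omega_k)] between [UF] and the residual. It differs
    from the identity by [h1], which replaces [expm] by [expT], and by the error of [isO_expTNK]. *)
Lemma propagator_factor M A U k : mx_analytic A ->
  (forall al, is_TOexp (fun s => al%:C *: A s) (U al)) ->
  isO M M (fun al t => U al t - UF A al k t * residual M A U k al t).
Proof.
move=> hA hU; elim: k => [|k IH].
  by apply: eq_isO (isO0 M M) => al t; rewrite /UF big_ord0 mul1r subrr.
have hX := negOmega_isO A k hA; have hO := isON _ _ _ hX.
have [hW _ _] := residual_ode M A U k hA hU.
have hE := isO_weak _ _ _ _ _ (leqnSn M) (leqnSn M) (isO_expm_tail M.+1 _ hO).
have h1 := isOM _ _ _ _ _ _ hE (isO_expT M.+1 _ hX).
rewrite !addn0 in h1.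
have h2 := isOM _ _ _ _ _ _ (isOD _ _ _ _ h1 (isO_expTNK M _ hX)) hW.
have h3 := isOM _ _ _ _ _ _ (UF_isO A k hA) h2.
rewrite !addn0 !add0n in h3.
apply: eq_isO (isOB _ _ _ _ IH h3) => al t.
rewrite {1}/negOmega opprK mulrBl addrA subrK mulrBl mul1r mulrBr opprB.
by rewrite addrA subrK [in RHS]/UF big_ord_recr /= -/(UF A al k t) !mulrA.
Qed.

(** With [W] the residual, [U] is [UF * W] up to a negligible error, and [W - 1] vanishes at [0]
    with derivative of the order of [A_k], so integration gives one more power of [t]. *)
Lemma isO_UF_sub A U k : mx_analytic A ->
  (forall al, is_TOexp (fun s => al%:C *: A s) (U al)) ->
  isO (2 ^ k) (2 ^ k.+1 - 1) (fun al t => UF A al k t - U al t).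
Proof.
(* This order dominates both target exponents, [2 ^ k] in [al] and [2 ^ k.+1 - 1] in [t]. *)
move=> hA hU; pose M := (2 ^ k.+1)%N.
have kM : (2 ^ k <= M)%N by rewrite leq_exp2l.
have [W0 W1 [r hr dW]] := residual_ode M A U k hA hU.
have hD := isOM _ _ _ _ _ _ (taylor_isO _ _ _ _ (alphaA_taylor A k 0 hA)) W0.
rewrite !addn0 in hD.
have {}hD := isOD _ _ _ _ hD (isO_weak _ _ _ _ _ kM (leq_subr 2 M) hr).
have hW : isO (2 ^ k) (2 ^ k.+1 - 2).+1 (fun al t => residual M A U k al t - 1).
  apply: isO_primitive hD => [al t|al]; last by rewrite W1 subrr.
  have := mx_is_deriveD _ _ _ _ _ (dW al t) (mx_is_derive_cst (-1) t).
  by rewrite addr0.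
have e : (2 ^ k.+1 - 2).+1 = (2 ^ k.+1 - 1)%N.
  by rewrite -subSn ?subSS// -{1}(expn1 2) leq_exp2l.
rewrite e in hW.
have h1 := isOM _ _ _ _ _ _ (UF_isO A k hA) hW.
have h2 := isO_weak _ _ _ _ _ kM (leq_subr 1 M) (propagator_factor M A U k hA hU).
rewrite !add0n in h1.
apply: eq_isO (isON _ _ _ (isOD _ _ _ _ h2 h1)) => al t.
by rewrite mulrBr mulr1 addrA subrK opprB.
Qed.

End Residual.

Theorem theorem3 (R : realType) (n k : nat) (A0 : R -> 'M[R[i]]_n)
  (U : R -> R -> 'M[R[i]]_n) :
  mx_analytic A0 ->
  (forall alpha : R, is_TOexp (fun s => (alpha%:C) *: A0 s) (U alpha)) ->
  exists (K delta : R), 0 < delta /\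
    forall alpha t : R, `|alpha| < delta -> `|t| < delta ->
      opnorm (UF A0 alpha k t - U alpha t)
        <= K * `|alpha| ^+ (2 ^ k) * `|t| ^+ (2 ^ k.+1 - 1).
Proof.
move=> hA hU; have [K [d [_ d0 _ h]]] := isO_UF_sub A0 U k hA hU.
(* The factor 2 is the cost of passing to the operator norm in [opnorm_le]. *)
exists (2 * K), d; split=> // al t ha ht.
apply: le_trans (opnorm_le _) _.
by rewrite -!mulrA ler_wpM2l// mulrA h.
Qed.
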